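(* Let $\lambda$ and $\lambda'$ be partitions with at most $n$ parts, let $\beta\in U_\lambda(n)$ and $\pi\in S_n^{\lambda'}$, and suppose $s_\lambda(\beta;x)=d_{\lambda'}(\pi;x)$ as polynomials. Then $Q_\lambda(\beta)=Y_{\lambda'}(\pi)$. Hence $\lambda=\lambda'$ and $\Delta_\lambda(\beta)=\Psi_\lambda(\pi)$. Moreover $\pi$ is $\lambda$-312-avoiding and $\Delta_\lambda(\beta)\in UG_\lambda(n)$ (so $\beta\in UGC_\lambda(n)$); consequently the only row bound sums that equal Demazure polynomials are those identical to flag Schur polynomials. Furthermore $s_\lambda(\beta;x)\equiv d_{\lambda'}(\pi;x)$, and $s_\lambda(\beta;x)$ is identical to the flag Schur polynomial $s_\lambda(\Phi_\lambda[\Delta_\lambda(\beta)];x)$.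
   Context: Fix $n\ge1$, $[n]=\{1,\dots,n\}$, variables $x_1,\dots,x_n$. A partition $\lambda=(\lambda_1\ge\dots\ge\lambda_n\ge0)$; box $(j,i)$ of its shape is in column $j$, row $i$. $R_\lambda\subseteq[n-1]$ is the set of distinct column lengths of $\lambda$ less than $n$, written $q_1<\dots<q_r$, $q_0:=0$, $q_{r+1}:=n$; carrels are $(q_{h-1},q_h]$, $h\in[r+1]$. $\lambda$-tuples: $n$-tuples with entries in $[n]$; upper if $\beta_i\ge i$. $U_\lambda(n)$ upper ones; $UF_\lambda(n)$ weakly increasing upper ones; $UI_\lambda(n)$ upper ones strictly increasing on each carrel. Critical indices of $\beta$: in carrel $h$ put $x_1:=q_h$; recursively $x_u$ is the largest index with $q_{h-1}<x_u<x_{u-1}$ and $\beta_{x_{u-1}}-\beta_{x_u}>x_{u-1}-x_u$, stopping when none exists. $\Delta_\lambda(\beta)_i:=\beta_x-(x-i)$, $x$ the smallest critical index $\ge i$ in the carrel of $i$. $UGC_\lambda(n)$: $\beta$ whose critical entries, listed by increasing critical index, weakly increase; $UG_\lambda(n):=UGC_\lambda(n)\cap UI_\lambda(n)$. $\Phi_\lambda(\gamma)$ for $\gamma\in UG_\lambda(n)$: $\tau_x=\gamma_x$ at critical indices; for non-critical $i$, with $x$ the smallest critical index $\ge i$ in its carrel, $\tau_i:=\max\{\gamma_{q_h},\gamma_x-(x-i)\}$ if $i$ is in carrel $h+1$ ($h\in[r]$) and $x$ is the smallest critical index of that carrel, else $\tau_i:=\gamma_x-(x-i)$; this is an upper flag.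 $S_n^\lambda$: permutations $\pi$ of $[n]$ increasing on each carrel; $B_h:=\{\pi_1,\dots,\pi_{q_h}\}$. $\pi$ is $\lambda$-312-avoiding if there are no $h\in[r-1]$ and $a\le q_h<b\le q_{h+1}<c$ with $\pi_a>\pi_c>\pi_b$. $\Psi_\lambda(\pi)=\psi$: for $i$ in carrel $h$, $\psi_i$ is the $(q_h-i+1)$-th largest element of $B_h$. $\mathcal{T}_\lambda$: semistandard tableaux of shape $\lambda$ with entries in $[n]$, ordered entrywise; content $\Theta(T)$; weight $x^{\Theta(T)}=\prod x_i^{\theta_i}$. $\mathcal{S}_\lambda(\beta):=\{T:T_j(i)\le\beta_i\ \forall (j,i)\}$; row bound sum $s_\lambda(\beta;x):=\sum_{T\in\mathcal{S}_\lambda(\beta)}x^{\Theta(T)}$ (flag Schur polynomial when $\beta\in UF_\lambda(n)$). $Q_\lambda(\beta)$: entrywise maximum of $\mathcal{S}_\lambda(\beta)$. $Y_\lambda(\pi)$: tableau of shape $\lambda$ whose columns of length $q_h$ have entry set $B_h$ and columns of length $n$ have entry set $[n]$. $\mathcal{D}_\lambda(\pi):=\{T:K_+(T)\le Y_\lambda(\pi)\}$ with $K_+(T)$ the Lascoux–Schützenberger right key; $d_\lambda(\pi;x):=\sum_{T\in\mathcal{D}_\lambda(\pi)}x^{\Theta(T)}$. Identical ($\equiv$) means equal underlying tableau sets. *)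

(* Defs.v *)
From HB Require Import structures.
From mathcomp Require Import all_boot all_order all_fingroup all_algebra.
From mathcomp Require Import finmap mpoly.

Set Implicit Arguments.
Unset Strict Implicit.
Unset Printing Implicit Defensive.

Local Open Scope nat_scope.

(* Indices, tuple entries and tableau entries are all numbered from 0: the
   index or value k of the mathematics is k - 1 here.  Column lengths and
   carrel numbers are not shifted, so the carrel (q_{h-1}, q_h] becomes the
   set of i : 'I_n with q_{h-1} <= i < q_h. *)

Definition is_partition n (la : n.-tuple nat) : bool := sorted geq la.

Definition ncols n (la : n.-tuple nat) : nat := head 0 la.

Definition col_lengths n (la : n.-tuple nat) : seq nat :=
  [seq count (fun m => j < m) la | j <- iota 0 (ncols la)].

Section Carrels.

Variables (n : nat) (la : n.-tuple nat).

Definition Rset : seq nat := [seq q <- iota 1 n.-1 | q \in col_lengths la].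

Definition rnum : nat := size Rset.

(* q_0 = 0 < q_1 < ... < q_r < q_{r+1} = n. *)
Definition qq (h : nat) : nat := nth n (0 :: rcons Rset n) h.

Definition carrel (h : nat) : seq 'I_n :=
  [seq i : 'I_n <- enum 'I_n | qq h.-1 <= i < qq h].

Definition carrel_of (i : 'I_n) : nat :=
  find (fun q => i < q) (0 :: rcons Rset n).

End Carrels.

Section LambdaTuples.

Variables (n : nat) (la : n.-tuple nat).

Implicit Types (be ga : {ffun 'I_n -> 'I_n}) (i x : 'I_n).

Definition upper be : bool := [forall i : 'I_n, i <= be i].

Definition UF be : bool :=
  upper be && [forall i : 'I_n, forall k : 'I_n, (i <= k) ==> (be i <= be k)].

Definition UI be : bool :=
  upper be &&
  [forall i : 'I_n, forall k : 'I_n, (carrel_of la i == carrel_of la k) && (i < k)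
                       ==> (be i < be k)].

(* x is the last critical index found and ys lists, in decreasing order, the
   candidates below x.  Truncated subtraction is harmless: x - y > 0. *)
Fixpoint crit_below be x (ys : seq 'I_n) : seq 'I_n :=
  if ys is y :: ys' then
    if x - y < be x - be y then y :: crit_below be y ys'
    else crit_below be x ys'
  else [::].

(* The critical indices of be in carrel h, in increasing order. *)
Definition crit be (h : nat) : seq 'I_n :=
  if rev (carrel la h) is x :: ys then rev (x :: crit_below be x ys)
  else [::].

(* The smallest critical index >= i in the carrel of i. *)
Definition next_crit be i : 'I_n :=
  head i [seq x : 'I_n <- crit be (carrel_of la i) | i <= x].

Definition critical_indices be : seq 'I_n :=
  flatten [seq crit be h | h <- iota 1 (rnum la).+1].

(* b - k as an element of 'I_n; below it is used with k = x - i and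
   b = be x, where no truncation occurs if be is upper. *)
Definition ord_sub (b : 'I_n) (k : nat) : 'I_n :=
  Ordinal (leq_ltn_trans (leq_subr k b) (ltn_ord b)).

Definition Delta be : {ffun 'I_n -> 'I_n} :=
  [ffun i => ord_sub (be (next_crit be i)) (next_crit be i - i)].

Definition UGC be : bool :=
  upper be && sorted leq [seq val (be x) | x <- critical_indices be].

Definition UG be : bool := UGC be && UI be.

Definition Phi ga : {ffun 'I_n -> 'I_n} :=
  [ffun i =>
    let h := carrel_of la i in
    let x := next_crit ga i in
    if i \in crit ga h then ga i
    else if (1 < h) && (x == head i (crit ga h)) then
      Order.max (ga (last i (carrel la h.-1))) (ord_sub (ga x) (x - i))
    else ord_sub (ga x) (x - i)].

Implicit Type pi : 'S_n.

Definition lambda_perm pi : bool :=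
  [forall i : 'I_n, forall k : 'I_n, (carrel_of la i == carrel_of la k) && (i < k)
                       ==> (pi i < pi k)].

Definition prefix_set pi (l : nat) : {set 'I_n} :=
  [set pi i | i : 'I_n & i < l].

Definition Bset pi (h : nat) : {set 'I_n} := prefix_set pi (qq la h).

Definition avoids_312 pi : Prop :=
  forall (h : nat) (a b c : 'I_n),
    1 <= h < rnum la ->
    a < qq la h -> qq la h <= b < qq la h.+1 -> qq la h.+1 <= c ->
    ~ (pi b < pi c < pi a).

Definition Psi pi : {ffun 'I_n -> 'I_n} :=
  [ffun i =>
    let h := carrel_of la i in
    nth i (rev (enum (Bset pi h))) (qq la h - i.+1)].

End LambdaTuples.

(* A tableau is the list of its columns, each column being listed from top to
   bottom; T_j(i) is  nth 0 (nth [::] T j) i. *)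
Definition tableau : Type := seq (seq nat).

Definition tab_le (T U : tableau) : bool := all2 (all2 leq) T U.

Definition row_le (C D : seq nat) : bool := all2 leq (take (size D) C) D.

Definition is_ssyt n (la : n.-tuple nat) (T : tableau) : bool :=
  [&& shape T == col_lengths la,
      all (all (fun x => x < n)) T,
      all (sorted ltn) T
    & sorted row_le T].

(* Columns have at most n entries, all in 'I_n, so the tableaux of shape la
   are found among the images of a finite type. *)
Definition tableaux n (la : n.-tuple nat) : {fset tableau} :=
  [fset T in
    [seq [seq [seq val x | x <- val C] | C <- val t]
       | t <- enum {: (ncols la).-tuple (n.-bseq 'I_n)}]
    | is_ssyt la T]%fset.

Lemma in_tableaux n (la : n.-tuple nat) (T : tableau) :
  (T \in tableaux la) = is_ssyt la T.
Proof.
rewrite !inE /= andbC; case ssT: (is_ssyt la T) => //=.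
have /and4P[/eqP shT entT colT _] := ssT.
have szT : size T = ncols la.
  by rewrite -(size_map size) -/(shape T) shT size_map size_iota.
have szC C : C \in T -> size C <= n.
  move=> CT; rewrite -(size_iota 0 n); apply: uniq_leq_size.
    exact: sorted_uniq ltn_trans ltnn _ (allP colT _ CT).
  by move=> x xC; rewrite mem_iota; exact: (allP (allP entT _ CT)).
pose f (C : seq nat) : n.-bseq 'I_n := insub_bseq n (pmap insub C).
have fK C : C \in T -> [seq val x | x <- f C] = C.
  move=> CT; have sfC : size (pmap (insub : nat -> option 'I_n) C) <= n.
    by rewrite size_pmap (leq_trans (count_size _ _)) ?szC.
  rewrite /f /insub_bseq val_insubd sfC.
  rewrite (pmap_filter (insubK _)) (@eq_filter _ _ (fun x => x < n)).
    exact/all_filterP/(allP entT).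
  by move=> x; rewrite isSome_insub.
have szf : size (map f T) == ncols la by rewrite size_map szT.
apply/mapP; exists (Tuple szf); first by rewrite mem_enum.
rewrite /= -map_comp -[LHS]map_id; apply/eq_in_map => C CT /=.
by rewrite fK.
Qed.

Definition content n (T : tableau) : 'X_{1..n} :=
  [multinom count_mem (val i) (flatten T) | i < n].

Definition weight_sum n (A : {fset tableau}) : {mpoly int[n]} :=
  (\sum_(T <- A) 'X_[int, content n T])%R.

Section RowBounds.

Variables (n : nat) (la : n.-tuple nat) (be : {ffun 'I_n -> 'I_n}).

Definition Sset : {fset tableau} :=
  [fset T in tableaux la |
    all (fun C => [forall i : 'I_n, (i < size C) ==> (nth 0 C i <= be i)]) T]%fset.

Definition row_bound_sum : {mpoly int[n]} := weight_sum n Sset.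

Definition Qtab : tableau :=
  [seq [seq \max_(T <- Sset) nth 0 (nth [::] T j) i
         | i <- iota 0 (nth 0 (col_lengths la) j)]
    | j <- iota 0 (ncols la)].

End RowBounds.

(* Jeu de taquin on two columns.  The left column A occupies the rows
   k, k+1, ... and the right column B the rows 0, ..., size B - 1.  The hole
   starts at the bottom of B and climbs; [slide_row A B k r] is the row where,
   arriving from row r of the right column, it moves to the left column. *)
Fixpoint slide_row (A B : seq nat) (k r : nat) : nat :=
  if r is r'.+1 then
    if (k < r) && (nth 0 A (r - k) <= nth 0 B r') then slide_row A B k r'
    else r
  else 0.

(* The entry of A met in that row moves right, and the entries of A above it
   move down, so that A then starts one row lower. *)
Definition slide (A B : seq nat) (k : nat) : seq nat * seq nat :=
  let r := slide_row A B k (size B) in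
  (take (r - k) A ++ drop (r - k).+1 A,
   take r B ++ nth 0 A (r - k) :: drop r B).

Fixpoint slides (A B : seq nat) (k m : nat) : seq nat * seq nat :=
  if m is m'.+1 then
    let AB := slide A B k in slides AB.1 AB.2 k.+1 m'
  else (A, B).

(* The right column of the skew tableau obtained from the two-column tableau
   (C, D) when the two column lengths are exchanged by jeu de taquin. *)
Definition swap_right (C D : seq nat) : seq nat :=
  (slides C D 0 (size C - size D)).2.

(* The Lascoux-Schutzenberger right key: its j-th column is the last column of
   the frank skew tableau obtained from T by carrying the length of the j-th
   column to the last position, one adjacent exchange at a time. *)
Fixpoint right_key (T : tableau) : tableau :=
  if T is C :: T' then foldl swap_right C T' :: right_key T' else [::].

Section Demazure.

Variables (n : nat) (la : n.-tuple nat) (pi : 'S_n).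

(* A column of length l = q_h is B_h, and one of length n is all of 'I_n. *)
Definition Ytab : tableau :=
  [seq [seq val x | x <- enum (prefix_set pi l)] | l <- col_lengths la].

Definition Dset : {fset tableau} :=
  [fset T in tableaux la | tab_le (right_key T) Ytab]%fset.

Definition demazure_poly : {mpoly int[n]} := weight_sum n Dset.

End Demazure.

(* Main.v *)
(* Both tableau sets have a least element (row [i] filled with [i]) and a largest
   one, [Qtab] and [Ytab]; each is the only tableau of its set with extremal sum
   of entries, so the polynomials determine its content.  The content of the
   least tableau is the shape, and a key is determined by its shape and content;
   hence the shapes agree and [Qtab = Ytab].  Since a tableau lies below its
   right key, [Dset] is contained in [Sset], and equality of the polynomials
   makes the two sets equal.

   The column of length [q] of [Qtab] has entries
   [colmax q i = min over i <= k < q of (beta k - (k - i))].  If a critical entry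
   of a carrel were smaller than the last entry [beta e] of the preceding one,
   it would be followed by a gap in the column of [Qtab] ending that carrel.
   Lowering [beta e] to the first value [z] in this gap leaves that column
   unchanged but puts [z] in the next shorter one.  A column of the right key
   strictly exceeds the column of the tableau as soon as some column further
   right has an entry not in it, so the largest tableau for the lowered bounds
   lies in [Sset] but not in [Dset].  Thus the critical entries increase.  This rules out
   312-patterns, whose middle value is again in a gap of a column of [Qtab],
   and makes [Phi] a flag with the same row bound set. *)

Require Import Defs.
From mathcomp Require Import all_boot all_order all_fingroup all_algebra.
From mathcomp Require Import finmap mpoly.
From mathcomp Require Import zify.

Set Implicit Arguments.
Unset Strict Implicit.
Unset Printing Implicit Defensive.

Local Open Scope nat_scope.

(** * Strict columns and the right key *)

Lemma sorted_ltn_nth_lt (C : seq nat) i j :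
  sorted ltn C -> i < j -> j < size C -> nth 0 C i < nth 0 C j.
Proof.
move=> sC ij jC; apply: (sorted_ltn_nth ltn_trans) => //.
by rewrite inE (ltn_trans ij).
Qed.

Lemma sorted_ltn_nth_le (C : seq nat) i j :
  sorted ltn C -> i <= j -> j < size C -> nth 0 C i <= nth 0 C j.
Proof.
move=> sC; rewrite leq_eqVlt => /orP[/eqP-> //|ij] jC.
exact/ltnW/sorted_ltn_nth_lt.
Qed.

Lemma sorted_ltn_uniq (C : seq nat) : sorted ltn C -> uniq C.
Proof. exact: sorted_uniq ltn_trans ltnn C. Qed.

Lemma sorted_ltn_eq (C D : seq nat) :
  sorted ltn C -> sorted ltn D -> C =i D -> C = D.
Proof. exact: (irr_sorted_eq ltn_trans ltnn). Qed.

Lemma sorted_ltn_subset_eq (C D : seq nat) :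
  sorted ltn C -> sorted ltn D -> {subset C <= D} -> size D <= size C -> C = D.
Proof.
move=> sC sD CD szD; apply: sorted_ltn_eq => //.
exact: (uniq_min_size (sorted_ltn_uniq sC) CD szD).2.
Qed.

Lemma leq_nth_sorted_ltn (C : seq nat) i :
  sorted ltn C -> i < size C -> i <= nth 0 C i.
Proof.
move=> sC; elim: i => // i IH iC.
exact: leq_ltn_trans (IH (ltnW iC)) (sorted_ltn_nth_lt sC _ iC).
Qed.

(** Pigeonhole: otherwise the first [i.+1] entries of [D] would all lie among the first [i] entries
    of [C]. *)
Lemma sorted_ltn_superset_nth (C D : seq nat) i :
  sorted ltn C -> sorted ltn D -> {subset D <= C} -> i < size D ->
  nth 0 C i <= nth 0 D i.
Proof.
move=> sC sD DC iD; rewrite leqNgt; apply/negP => lt_DC.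
have sub : {subset take i.+1 D <= take i C}.
  move=> x /[dup] xt /mem_take /DC xC.
  have xD : x <= nth 0 D i.
    have [/= j jt <-] := nthP 0 xt; move: jt; rewrite size_take_min leq_min.
    by case/andP=> ji jD; rewrite nth_take ?sorted_ltn_nth_le.
  rewrite -(nth_index 0 xC); set j := index x C.
  have jC : j < size C by rewrite index_mem.
  have ji : j < i.
    rewrite ltnNge; apply/negP => ij.
    have := sorted_ltn_nth_le sC ij jC; rewrite /j nth_index // => xi.
    by have := leq_trans (leq_ltn_trans xD lt_DC) xi; rewrite ltnn.
  rewrite -(nth_take 0 ji) mem_nth // size_take_min leq_min ji jC //.
have := uniq_leq_size (take_uniq _ (sorted_ltn_uniq sD)) sub.
by rewrite size_takel // size_take_min leqNgt ltnS geq_minl.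
Qed.

Lemma all2_nthP (T U : Type) (t0 : T) (u0 : U) (p : T -> U -> bool) s t :
  reflect (size s = size t /\
           forall i, i < size s -> p (nth t0 s i) (nth u0 t i))
          (all2 p s t).
Proof.
elim: s t => [|x s IH] [|y t] /=; try by constructor; case.
  by constructor; split.
apply: (iffP andP) => [[pxy /IH[-> st]]|[[st] pst]].
  by split=> // -[|i] //=; apply: st.
by split; [apply: (pst 0) | apply/IH; split=> // i; apply: (pst i.+1)].
Qed.

Lemma row_leP (C D : seq nat) :
  reflect (size D <= size C /\ forall i, i < size D -> nth 0 C i <= nth 0 D i)
          (row_le C D).
Proof.
apply: (iffP (all2_nthP 0 0 _ _ _)); rewrite size_take_min => -[sz le_CD].
  have DC : size D <= size C by lia.
  split=> // i iD; rewrite -(nth_take 0 iD); apply: le_CD; lia.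
split; first by lia.
move=> i; rewrite leq_min => /andP[iD _]; rewrite nth_take //; exact: le_CD.
Qed.

(** * Exchange of two columns by jeu de taquin *)

Lemma nth_insert (B : seq nat) r c i : r <= size B ->
  nth 0 (take r B ++ c :: drop r B) i =
  if i < r then nth 0 B i else if i == r then c else nth 0 B i.-1.
Proof.
move=> rB; rewrite nth_cat size_takel //; case: ltnP => [ir|ri].
  by rewrite nth_take.
case: eqP => [->|]; first by rewrite subnn.
case: i ri => [|i] ri ne; first by lia.
rewrite subSn; last by lia.
by rewrite /= nth_drop; congr nth; lia.
Qed.

(** The hole cannot climb above row [rho]: there its left neighbour exceeds its upper one, or
    [rho = k], where [slide_row] stops anyway. The last clause collects the comparisons made on the
    way. *)
Lemma slide_rowP A B k rho r0 : k <= rho <= r0 ->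
    (k < rho -> nth 0 B rho.-1 < nth 0 A (rho - k)) ->
  let r := slide_row A B k r0 in
  [/\ rho <= r <= r0, rho < r -> nth 0 B r.-1 < nth 0 A (r - k)
    & forall i, r <= i < r0 -> nth 0 A (i.+1 - k) <= nth 0 B i].
Proof.
move=> + H; elim: r0 => [|r IH] /= krho.
  by split; [lia | lia | move=> i; lia].
case: ifPn => [/andP[kr le_AB]|].
  have rho_r : rho <= r.
    rewrite leqNgt; apply/negP => rrho; have e : rho = r.+1 by lia.
    by move: H; rewrite e /= => /(_ kr); lia.
  have [|rr lt_BA le] := IH; first by lia.
  split=> [|//|i /andP[]]; first by lia.
  rewrite leq_eqVlt => /orP[/eqP<- _|ri ir]; last first.
    have [e|] := eqVneq i r; first by rewrite e.
    by move=> ne; apply: le; lia.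
  have [e|ne] := eqVneq (slide_row A B k r) r; first by rewrite e.
  by apply: le; lia.
rewrite negb_and -leqNgt -ltnNge => /orP[rk|lt_BA].
  by split; [lia|lia|move=> i; lia].
by split; [lia| |move=> i; lia].
Qed.

(* The rows of [A] from [rho] on are still those of [C], and each slide leaves
   the left column at a row [>= rho], strictly below the previous one. *)
Lemma slidesP (C : seq nat) : sorted ltn C -> forall m A B k rho,
    size B + m = size C -> k + size A = size C -> k <= rho <= size B ->
    (forall i, rho <= i < size C -> nth 0 A (i - k) = nth 0 C i) ->
    (forall i, i < size B -> nth 0 C i <= nth 0 B i) -> sorted ltn B ->
    (0 < rho < size C -> nth 0 B rho.-1 < nth 0 C rho) ->
  let X := (slides A B k m).2 in
  [/\ size X = size C, sorted ltn X,
      forall i, i < size C -> nth 0 C i <= nth 0 X i,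
      {subset B <= X} & {subset X <= B ++ C}].
Proof.
move=> sC; elim=> [|m IH] A B k rho szB szA krho AC CB sB Brho.
  by rewrite addn0 in szB; split; rewrite -?szB // => x xB; rewrite mem_cat xB.
rewrite /= /slide; have [|] := @slide_rowP A B k rho (size B) krho.
  by rewrite AC => [?|]; [apply: Brho; lia | lia].
set r := slide_row _ _ _ _ => rr ltr ler.
have Ar : nth 0 A (r - k) = nth 0 C r by apply: AC; lia.
have rB : r <= size B by lia.
have rC : r < size C by lia.
have szB' : size (take r B ++ nth 0 A (r - k) :: drop r B) = (size B).+1.
  by rewrite size_cat /= size_takel // size_drop; lia.
have [] := IH (take (r - k) A ++ drop (r - k).+1 A)
  (take r B ++ nth 0 A (r - k) :: drop r B) k.+1 r.+1.
- by rewrite szB' addSn -addnS.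
- rewrite size_cat size_takel ?size_drop; lia.
- by rewrite szB'; lia.
- move=> i ri; rewrite nth_cat size_takel; last by lia.
  rewrite ifF; last by lia.
  by rewrite nth_drop -AC; [congr nth; lia | lia].
- move=> i; rewrite szB' nth_insert // Ar => iB.
  case: ltnP => [ir|ri]; first by apply: CB; lia.
  case: eqP => [-> //|ne].
  rewrite -AC; last by lia.
  have -> : i = i.-1.+1 by lia.
  by apply: ler; lia.
(* The inserted entry is [nth 0 C r]. It exceeds its upper neighbour because the hole turned left
   there, or by the invariant if [r = rho]. It is below its lower neighbour because [nth 0 C r.+1]
   is at most that neighbour, as the hole passed row [r.+1]. *)
- apply/(sortedP 0) => i; rewrite szB' !nth_insert // Ar => iB /=.
  case: (ltngtP i.+1 r) => [ir|ri|e].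
  + by apply: sorted_ltn_nth_lt => //; lia.
  + case: eqP => [->|ne]; last by apply: sorted_ltn_nth_lt => //; lia.
    rewrite -Ar; apply: leq_trans (ler r _); last by lia.
    rewrite Ar AC; last by lia.
    by apply: sorted_ltn_nth_lt => //; lia.
  + rewrite (_ : i = r.-1); last by lia.
    have [e'|ne] := eqVneq r rho; last by rewrite -Ar; apply: ltr; lia.
    by rewrite e'; apply: Brho; lia.
- rewrite nth_insert // /= ltnn eqxx Ar => rC'.
  by apply: sorted_ltn_nth_lt => //; lia.
set X := (slides _ _ _ _).2 => szX sX CX BX XB; split=> // x.
- move=> xB; apply: BX; rewrite mem_cat inE orbCA.
  by rewrite -mem_cat cat_take_drop xB orbT.
- move=> /XB; rewrite mem_cat => /orP[|xC]; last by rewrite mem_cat xC orbT.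
  rewrite mem_cat inE orbCA -mem_cat cat_take_drop => /orP[/eqP->|xB].
    by rewrite mem_cat Ar (mem_nth 0 rC) orbT.
  by rewrite mem_cat xB.
Qed.

(** These properties are all that is used about jeu de taquin; the exchanged column is never
    computed. *)
Lemma swap_rightP (C D : seq nat) :
    sorted ltn C -> sorted ltn D -> row_le C D ->
  [/\ size (swap_right C D) = size C, sorted ltn (swap_right C D),
      forall i, i < size C -> nth 0 C i <= nth 0 (swap_right C D) i,
      {subset D <= swap_right C D} & {subset swap_right C D <= D ++ C}].
Proof.
move=> sC sD /row_leP[szD CD].
apply: (@slidesP _ sC _ _ _ _ 0) => //; first by rewrite subnKC.
by move=> i _; rewrite subn0.
Qed.

(** All entries of the exchanged column come from [C], and it has the size of [C]. *)
Lemma swap_right_id (C D : seq nat) :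
  sorted ltn C -> sorted ltn D -> {subset D <= C} -> swap_right C D = C.
Proof.
move=> sC sD DC; have rCD : row_le C D.
  apply/row_leP; split; last by move=> i; apply: sorted_ltn_superset_nth.
  exact: uniq_leq_size (sorted_ltn_uniq sD) DC.
have [szX sX _ _ XDC] := swap_rightP sC sD rCD.
apply: sorted_ltn_subset_eq; rewrite ?szX // => x /XDC.
by rewrite mem_cat => /orP[/DC|].
Qed.

(** The exchanged column contains [D], so on the rows of [D] it is at most [D], hence compatible
    with the column that follows. *)
Lemma path_swap_right (C D : seq nat) (T : tableau) :
    sorted ltn C -> sorted ltn D -> row_le C D -> path row_le D T ->
  path row_le (swap_right C D) T.
Proof.
move=> sC sD rCD; case: T => //= E T /andP[/row_leP[szE DE] ->]; rewrite andbT.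
have /row_leP[szDC _] := rCD.
have [szX sX CX DX _] := swap_rightP sC sD rCD.
apply/row_leP; split=> [|i iE]; first by rewrite szX (leq_trans szE).
apply: leq_trans (DE _ iE); apply: sorted_ltn_superset_nth => //.
exact: leq_trans iE szE.
Qed.

Lemma foldl_swap_rightP (T U : tableau) (C : seq nat) :
    sorted ltn C -> all (sorted ltn) T -> path row_le C (T ++ U) ->
  let X := foldl swap_right C T in
  [/\ size X = size C, sorted ltn X,
      forall i, i < size C -> nth 0 C i <= nth 0 X i & path row_le X U].
Proof.
elim: T C => [|D T IH] C sC /=; first by split.
case/andP=> sD sT /andP[rCD pT].
have [szX sX CX DX _] := swap_rightP sC sD rCD.
have [-> sY XY pY] := IH _ sX sT (path_swap_right sC sD rCD pT).
split=> // i iC; apply: leq_trans (CX i iC) (XY i _); by rewrite szX.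
Qed.

(** * The right key *)

Lemma nth_right_key (T : tableau) j : j < size T ->
  nth [::] (right_key T) j = foldl swap_right (nth [::] T j) (drop j.+1 T).
Proof.
by elim: T j => [|C T IH] [|j] //=; rewrite ?drop0 // ltnS => /IH.
Qed.

Lemma size_right_key (T : tableau) : size (right_key T) = size T.
Proof. by elim: T => //= C T ->. Qed.

Lemma tab_leP (T U : tableau) :
  reflect [/\ size T = size U,
      forall j, j < size T -> size (nth [::] T j) = size (nth [::] U j)
    & forall j i, j < size T -> i < size (nth [::] T j) ->
        nth 0 (nth [::] T j) i <= nth 0 (nth [::] U j) i]
  (tab_le T U).
Proof.
apply: (iffP (all2_nthP [::] [::] _ _ _)) => [[sz H]|[sz Hs H]].
  by split=> // j; [case/H/(all2_nthP 0 0) | move=> i /H/(all2_nthP 0 0)[_]; apply].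
by split=> // j jT; apply/(all2_nthP 0 0); split=> [|i]; [apply: Hs | apply: H].
Qed.

Lemma tab_le_refl (T : tableau) : tab_le T T.
Proof. exact/tab_leP. Qed.

Lemma tab_le_trans (T U V : tableau) : tab_le T U -> tab_le U V -> tab_le T V.
Proof.
move=> /tab_leP[sTU cTU TU] /tab_leP[sUV cUV UV]; apply/tab_leP.
split=> [|j jT|j i jT iT]; first by rewrite sTU.
  by rewrite cTU // cUV // -sTU.
by apply: leq_trans (TU _ _ jT iT) (UV _ _ _ _); rewrite -?sTU -?cTU.
Qed.

Lemma path_drop_sorted (T : tableau) j : sorted row_le T -> j < size T ->
  path row_le (nth [::] T j) (drop j.+1 T).
Proof.
move=> sT jT; have := drop_sorted j sT; by rewrite (drop_nth [::] jT).
Qed.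

(** No exchange lowers an entry. *)
Lemma tab_le_right_key (T : tableau) :
  all (sorted ltn) T -> sorted row_le T -> tab_le T (right_key T).
Proof.
move=> cT rT.
have H j : j < size T -> sorted ltn (nth [::] T j).
  by move=> jT; apply: (allP cT); rewrite mem_nth.
have H' j : all (sorted ltn) (drop j T).
  by apply/allP => C /mem_drop; apply: (allP cT).
have X j : j < size T -> [/\ size (nth [::] (right_key T) j) = size (nth [::] T j)
    & forall i, i < size (nth [::] T j) ->
        nth 0 (nth [::] T j) i <= nth 0 (nth [::] (right_key T) j) i].
  move=> jT; rewrite nth_right_key //.
  have [|? _ ? _] := @foldl_swap_rightP (drop j.+1 T) [::] _ (H j jT) (H' j.+1).
    by rewrite cats0 path_drop_sorted.
  by split.
apply/tab_leP; split=> [|j /X[->]//|j i /X[_]]; last exact.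
by rewrite size_right_key.
Qed.

Lemma right_key_nested (T : tableau) :
  all (sorted ltn) T -> pairwise (fun C D => all (mem C) D) T ->
  right_key T = T.
Proof.
elim: T => //= C T IH /andP[sC sT] /andP[CT pT]; rewrite IH //; congr cons.
elim: T sT CT {IH pT} => //= D T IH /andP[sD sT] /andP[/allP DC CT].
by rewrite swap_right_id // IH.
Qed.

(** After the exchange with column [j'], the column carried from [j] contains [z], so it differs
    from column [j]. As exchanges never lower an entry, some entry has grown for good. *)
Lemma right_key_gt (T : tableau) j j' z :
    all (sorted ltn) T -> sorted row_le T -> j < j' -> j' < size T ->
    z \in nth [::] T j' -> z \notin nth [::] T j ->
  exists2 i, i < size (nth [::] T j)
    & nth 0 (nth [::] T j) i < nth 0 (nth [::] (right_key T) j) i.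
Proof.
move=> cT rT jj' j'T zj' zj; have jT : j < size T by apply: ltn_trans j'T.
have sC : sorted ltn (nth [::] T j) by apply: (allP cT); rewrite mem_nth.
have sD : sorted ltn (nth [::] T j') by apply: (allP cT); rewrite mem_nth.
have sub U : {subset U <= T} -> all (sorted ltn) U.
  by move=> UT; apply/allP => E /UT; apply: (allP cT).
have := path_drop_sorted rT jT; rewrite nth_right_key //.
have e : drop j.+1 T =
    take (j' - j.+1) (drop j.+1 T) ++ nth [::] T j' :: drop j'.+1 T.
  rewrite -{1}(cat_take_drop (j' - j.+1) (drop j.+1 T)) drop_drop subnK //.
  by rewrite (drop_nth [::] j'T).
rewrite e; set T1 := take _ _; set T2 := drop j'.+1 T.
set C := nth [::] T j in sC zj *; set D := nth [::] T j' in sD zj' *.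
have sT1 : all (sorted ltn) T1 by apply: sub => E /mem_take/mem_drop.
have sT2 : all (sorted ltn) T2 by apply: sub => E /mem_drop.
rewrite foldl_cat /= => pT.
have [szX sX CX /= /andP[rXD pD]] := foldl_swap_rightP sC sT1 pT.
set X := foldl swap_right C T1 in szX sX CX rXD pD *.
have [szY sY XY DY _] := swap_rightP sX sD rXD.
have := path_swap_right sX sD rXD pD.
set Y := swap_right X D in szY sY XY DY *; rewrite -{1}[T2]cats0 => pY.
have [szZ sZ YZ _] := foldl_swap_rightP sY sT2 pY.
have /hasP[i] : has (fun i => nth 0 C i < nth 0 Y i) (iota 0 (size C)).
  apply/contraT => /hasPn nCY; case/negP: zj.
  suff -> : C = Y by apply: DY.
  apply: (@eq_from_nth _ 0) => [|i iC]; first by rewrite szY szX.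
  have := nCY i; rewrite mem_iota => /(_ iC); rewrite -leqNgt => YC.
  apply/eqP; rewrite eqn_leq YC andbT; apply: leq_trans (CX _ iC) (XY _ _).
  by rewrite szX.
rewrite mem_iota /= => iC ltC; exists i => //.
by apply: leq_trans ltC (YZ _ _); rewrite szY szX.
Qed.

(** * Contents and tableaux given by columns *)

Lemma sumn_leq (s t : seq nat) : all2 leq s t -> sumn s <= sumn t.
Proof.
by elim: s t => [|x s IH] [|y t] //= /andP[xy /IH]; apply: leq_add.
Qed.

Lemma sumn_eq_leq (s t : seq nat) : all2 leq s t -> sumn s = sumn t -> s = t.
Proof.
elim: s t => [|x s IH] [|y t] //= /andP[xy st] e.
have := sumn_leq st => st'; have exy : x = y by lia.
by rewrite exy (IH t) //; lia.
Qed.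

Lemma tab_le_sumn (T U : tableau) :
  tab_le T U -> sumn (flatten T) <= sumn (flatten U).
Proof.
rewrite !sumn_flatten => TU; apply: sumn_leq; rewrite /tab_le in TU.
by elim: T U TU => [|C T IH] [|D U] //= /andP[/sumn_leq-> /IH].
Qed.

(** The entry sum is strictly monotone and depends only on the content, so contents can settle
    equality of comparable tableaux. *)
Lemma tab_le_sumn_eq (T U : tableau) :
  tab_le T U -> sumn (flatten T) = sumn (flatten U) -> T = U.
Proof.
rewrite !sumn_flatten => TU e.
have {}e : map sumn T = map sumn U.
  apply: sumn_eq_leq e.
  by elim: T U TU => [|C T IH] [|D U] //= /andP[/sumn_leq-> /IH].
elim: T U TU e => [|C T IH] [|D U] //= /andP[CD TU] [eCD eTU].
by rewrite (sumn_eq_leq CD eCD) (IH U).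
Qed.

Lemma content_perm n (T U : tableau) :
    all (fun x => x < n) (flatten T) -> all (fun x => x < n) (flatten U) ->
  content n T = content n U -> perm_eq (flatten T) (flatten U).
Proof.
move=> /allP Tn /allP Un /mnmP e; apply/allP => x xTU; apply/eqP.
have xn : x < n.
  by move: xTU; rewrite mem_cat => /orP[/Tn|/Un].
by have := e (Ordinal xn); rewrite !mnmE.
Qed.

(** The coefficient at [m] is the number of tableaux of content [m], and distinct numbers stay
    distinct in [int]. *)
Lemma weight_sum_count n (A B : {fset tableau}) m :
  weight_sum n A = weight_sum n B ->
  count (fun T => content n T == m) A = count (fun T => content n T == m) B.
Proof.
have H (E : {fset tableau}) :
    ((weight_sum n E)@_m = (count (fun T => content n T == m) E)%:R :> int)%R.
  rewrite /weight_sum GRing.raddf_sum /= -sum1_count GRing.natr_sum.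
  rewrite [RHS]big_mkcond; apply: eq_bigr => T _.
  by rewrite mcoeffX; case: eqP.
move=> e; have := H A; rewrite e H => /eqP.
by rewrite Num.Theory.eqr_nat => /eqP ->.
Qed.

Lemma weight_sum_content n (A B : {fset tableau}) T :
    weight_sum n A = weight_sum n B -> T \in A ->
  exists2 U, U \in B & content n U = content n T.
Proof.
move=> /(weight_sum_count (content n T)) e TA.
have : has (fun U => content n U == content n T) B.
  by rewrite has_count -e -has_count; apply/hasP; exists T.
by case/hasP=> U UB /eqP; exists U.
Qed.

(** Content by content, the two sets have equally many tableaux, so an inclusion is an equality. *)
Lemma weight_sum_fsubset_eq n (A B : {fset tableau}) :
  weight_sum n A = weight_sum n B -> {subset A <= B} -> A = B.
Proof.
move=> e AB; apply/fsetP => T; apply/idP/idP => [/AB //|TB].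
set m := content n T; have := weight_sum_count m e; rewrite -!size_filter => sz.
have sub : {subset [seq U <- A | content n U == m]
    <= [seq U <- B | content n U == m]}.
  by move=> U; rewrite !mem_filter => /andP[-> /AB].
have uA : uniq [seq U <- A | content n U == m] by exact/filter_uniq/fset_uniq.
have [_ /(_ T)] := uniq_min_size uA sub (eq_leq (esym sz)).
by rewrite !mem_filter eqxx TB /= => ->.
Qed.

(** Both sides say that the box in column [j] and row [i] belongs to the shape. *)
Lemma count_gt_sorted_geq (s : seq nat) i j : sorted geq s ->
  (i < count (fun m => j < m) s) = (j < nth 0 s i).
Proof.
elim: s i => [|a s IH] i /= sa; first by rewrite nth_nil !ltn0.
have le_a : all (geq a) s.
  by apply: order_path_min sa => x y z yx zx; apply: leq_trans zx yx.
case: (ltnP j a) => [ja|aj]; last first.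
  rewrite add0n (_ : count _ s = 0); last first.
    apply/eqP; rewrite -leqn0 leqNgt -has_count; apply/hasPn => x xs.
    by rewrite -leqNgt; apply: leq_trans (allP le_a x xs) aj.
  symmetry; apply/negbTE; rewrite -leqNgt; case: i => //= i.
  have [si|si] := leqP (size s) i; first by rewrite nth_default.
  by apply: leq_trans aj; apply: (allP le_a); rewrite mem_nth.
by case: i => [|i] //=; rewrite ltnS IH // (path_sorted sa).
Qed.

Section Columns.

Variables (n : nat) (la : n.-tuple nat).
Implicit Types (T U : tableau) (f : nat -> seq nat).

Lemma size_col_lengths : size (col_lengths la) = ncols la.
Proof. by rewrite size_map size_iota. Qed.

Lemma col_lengths_sorted : sorted geq (col_lengths la).
Proof.
rewrite sorted_map; apply: (sub_sorted _ (iota_sorted _ _)) => j k jk /=.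
by apply: sub_count => m; apply: leq_ltn_trans.
Qed.

Lemma col_lengths_pairwise : pairwise geq (col_lengths la).
Proof.
rewrite -sorted_pairwise ?col_lengths_sorted // => x y z yx zx.
exact: leq_trans zx yx.
Qed.

Lemma col_lengths_le l : l \in col_lengths la -> l <= n.
Proof.
by case/mapP=> j _ ->; rewrite -{2}(size_tuple la) count_size.
Qed.

Lemma ssyt_size T : is_ssyt la T -> size T = size (col_lengths la).
Proof. by case/and4P=> /eqP<- _ _ _; rewrite size_map. Qed.

Lemma ssyt_size_col T j : is_ssyt la T ->
  size (nth [::] T j) = nth 0 (col_lengths la) j.
Proof. by case/and4P=> /eqP<- _ _ _; rewrite nth_shape. Qed.

Lemma ssyt_size_mem T C : is_ssyt la T -> C \in T -> size C \in col_lengths la.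
Proof. by case/and4P=> /eqP<- _ _ _; apply: map_f. Qed.

Lemma ssyt_sorted_col T C : is_ssyt la T -> C \in T -> sorted ltn C.
Proof. by case/and4P=> _ _ /allP + _; apply. Qed.

Lemma ssyt_flatten T : is_ssyt la T -> all (fun x => x < n) (flatten T).
Proof.
case/and4P=> _ /allP nT _ _; apply/allP => x /flattenP[C /nT/allP nC].
exact: nC.
Qed.

(** The least tableau, the largest one of a row bound set and the keys all have this form. *)
Definition col_tab f : tableau := map f (col_lengths la).

Lemma nth_col_tab f j : j < size (col_lengths la) ->
  nth [::] (col_tab f) j = f (nth 0 (col_lengths la) j).
Proof. exact: nth_map. Qed.

Lemma col_tab_ssyt f :
    {in col_lengths la, forall l,
      [/\ size (f l) = l, all (fun x => x < n) (f l) & sorted ltn (f l)]} ->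
    {in col_lengths la &, forall l l', l' <= l ->
      forall i, i < l' -> nth 0 (f l) i <= nth 0 (f l') i} ->
  is_ssyt la (col_tab f).
Proof.
move=> fP rP; apply/and4P; split.
- rewrite /shape -map_comp; apply/eqP; rewrite -[RHS]map_id.
  by apply/eq_in_map => l /fP[].
- by rewrite all_map; apply/allP => l /fP[].
- by rewrite all_map; apply/allP => l /fP[].
rewrite sorted_map.
apply: (@sub_in_sorted _ (mem (col_lengths la)) geq) col_lengths_sorted.
  2: by apply/allP.
move=> l l' lC l'C /= ll'; have [sl _ _] := fP l lC; have [sl' _ _] := fP l' l'C.
by apply/row_leP; rewrite sl sl'; split=> //; apply: rP.
Qed.

Section Nested.

Variable f : nat -> seq nat.
Hypothesis fP : {in col_lengths la, forall l,
  [/\ size (f l) = l, all (fun x => x < n) (f l) & sorted ltn (f l)]}.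
Hypothesis f_nested : {in col_lengths la &, forall l l', l' <= l ->
  {subset f l' <= f l}}.

Lemma nested_ssyt : is_ssyt la (col_tab f).
Proof.
apply: col_tab_ssyt => // l l' lC l'C ll' i il'.
have [_ _ sl] := fP lC; have [szl' _ sl'] := fP l'C.
by apply: sorted_ltn_superset_nth; rewrite ?szl' //; apply: f_nested.
Qed.

Lemma nested_right_key : right_key (col_tab f) = col_tab f.
Proof.
apply: right_key_nested; first by case/and4P: nested_ssyt.
rewrite pairwise_map.
apply: (@sub_in_pairwise _ (mem (col_lengths la)) geq) col_lengths_pairwise.
  2: by apply/allP.
by move=> l l' lC l'C ll'; apply/allP; apply: f_nested.
Qed.

(* The number of entries of a column that lie in [f l] is at most
   [minn l (size of the column)], with equality for the columns of [f]. *)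
Lemma nested_unique T :
  is_ssyt la T -> perm_eq (flatten T) (flatten (col_tab f)) -> T = col_tab f.
Proof.
move=> sT pT; have szT := ssyt_size sT.
apply: (@eq_from_nth _ [::]) => [|j]; first by rewrite (size_map f).
rewrite szT => jT; rewrite nth_col_tab //.
set l := nth 0 _ j; have lC : l \in col_lengths la by apply: mem_nth.
have [szl _ sl] := fP lC; pose p := mem (f l).
have colT k : k < size (col_lengths la) -> nth [::] T k \in T.
  by move=> kT; rewrite mem_nth ?szT.
(* The sums of both lists count the entries of the whole tableau lying in [f l], and [pT] makes them
   equal; so an inequality column by column suffices. *)
have eqc : map (count p) T = map (count p) (col_tab f).
  apply: sumn_eq_leq; last by rewrite -!count_flatten; apply/seq.permP.
  apply/(all2_nthP 0 0); rewrite !(size_map (count p)) (size_map f) szT; split=> // k kT.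
  rewrite (nth_map [::]) ?szT // (nth_map [::]) ?(size_map f) // nth_col_tab //.
  set l' := nth 0 _ k; have l'C : l' \in col_lengths la by apply: mem_nth.
  have [szl' _ sl'] := fP l'C.
  have sk : sorted ltn (nth [::] T k) by apply: ssyt_sorted_col (colT _ kT).
  case: (leqP l' l) => [l'l|ll'].
    rewrite (_ : count p (f l') = l').
      by rewrite /l' -(ssyt_size_col k sT) count_size.
    rewrite -[RHS]szl'; apply/eqP; rewrite -all_count; apply/allP.
    exact: f_nested.
  rewrite -!size_filter; apply: (@leq_trans l).
    rewrite -szl; apply: uniq_leq_size; first exact/filter_uniq/sorted_ltn_uniq.
    by move=> x; rewrite mem_filter => /andP[].
  rewrite -[X in X <= _]szl; apply: uniq_leq_size; first exact/sorted_ltn_uniq.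
  move=> x xl; rewrite mem_filter; apply/andP; split; first exact: xl.
  exact: (f_nested l'C lC (ltnW ll')).
have sj : size (nth [::] T j) = l by rewrite (ssyt_size_col j sT).
apply: sorted_ltn_subset_eq => //; last by rewrite sj szl.
  by apply: ssyt_sorted_col sT (colT _ jT).
suff /allP : all p (nth [::] T j) by [].
rewrite all_count sj; have := congr1 (fun s => nth 0 s j) eqc.
rewrite /= (nth_map [::]) ?szT // (nth_map [::]) ?(size_map f) // nth_col_tab //.
move=> ->; rewrite -[X in _ == X]szl -all_count; exact/allP.
Qed.

End Nested.

Definition min_tab : tableau := col_tab (iota 0).

Lemma iota_colP : {in col_lengths la, forall l,
  [/\ size (iota 0 l) = l, all (fun x => x < n) (iota 0 l)
    & sorted ltn (iota 0 l)]}.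
Proof.
move=> l /col_lengths_le ln; split; rewrite ?size_iota ?iota_ltn_sorted //.
by apply/allP => x; rewrite mem_iota => xl; apply: leq_trans ln.
Qed.

Lemma iota_nested : {in col_lengths la &, forall l l', l' <= l ->
  {subset iota 0 l' <= iota 0 l}}.
Proof. by move=> l l' _ _ l'l x; rewrite !mem_iota; lia. Qed.

Lemma min_tab_le T : is_ssyt la T -> tab_le min_tab T.
Proof.
move=> sT; have szT := ssyt_size sT; apply/tab_leP; rewrite (size_map (iota 0)).
split=> // [j jT|j i jT]; rewrite nth_col_tab // size_iota.
  by rewrite ssyt_size_col.
move=> ij; rewrite nth_iota //; apply: leq_nth_sorted_ltn.
  by apply: ssyt_sorted_col sT _; rewrite mem_nth ?szT.
by rewrite ssyt_size_col.
Qed.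

(** The value [i] fills row [i] of the least tableau and occurs nowhere else, so the content of this
    tableau recovers the partition. *)
Lemma count_min_tab i : is_partition la ->
  count_mem i (flatten min_tab) = nth 0 la i.
Proof.
move=> pla; rewrite count_flatten -map_comp.
have -> : map (count_mem i \o iota 0) (col_lengths la) =
          [seq (j < nth 0 la i : nat) | j <- iota 0 (ncols la)].
  rewrite -map_comp; apply: eq_map => j /=.
  rewrite count_uniq_mem ?iota_uniq // mem_iota /= add0n; congr (nat_of_bool _).
  exact: count_gt_sorted_geq.
have le : nth 0 la i <= ncols la.
  rewrite leqNgt /ncols -nth0 -count_gt_sorted_geq // -leqNgt.
  apply: (@leq_trans 0) => //; rewrite leqNgt count_gt_sorted_geq // nth0.
  by rewrite ltnn.
rewrite sumn_count -(subnKC le) iotaD count_cat.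
rewrite (_ : count _ (iota 0 _) = nth 0 la i).
  rewrite (_ : count _ _ = 0) ?addn0 //; apply/eqP; rewrite -leqn0 leqNgt -has_count.
  by apply/hasPn => x; rewrite mem_iota -leqNgt => /andP[].
rewrite -[RHS](size_iota 0); apply/eqP; rewrite -all_count.
by apply/allP => x; rewrite mem_iota.
Qed.

End Columns.

(** * The largest tableaux of the two sets *)

Section ColumnMax.

Variable b : nat -> nat.

(** [d] is the number of rows below row [i]. Once [k <= b k] for all [k], the value in row [i.+1] is
    positive and the predecessor is not truncated. *)
Fixpoint col_low d i :=
  if d is d'.+1 then minn (b i) (col_low d' i.+1).-1 else b i.

(* The largest value that row [i] of a strict column of length [q] with row
   bounds [b] can take: the minimum over [i <= k < q] of [b k - (k - i)]. *)
Definition colmax q i := col_low (q.-1 - i) i.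

Lemma colmax_last q : colmax q.+1 q = b q.
Proof. by rewrite /colmax /= subnn. Qed.

Lemma colmax_step q i :
  i.+1 < q -> colmax q i = minn (b i) (colmax q i.+1).-1.
Proof.
by move=> iq; rewrite /colmax (_ : q.-1 - i = (q.-1 - i.+1).+1) //; lia.
Qed.

Lemma colmax_le q i : colmax q i <= b i.
Proof.
rewrite /colmax; case: (q.-1 - i) => //= d; exact: geq_minl.
Qed.

Hypothesis b_upper : forall k, k <= b k.

Lemma colmax_ge q i : i <= colmax q i.
Proof.
rewrite /colmax; move: (q.-1 - i) => d; elim: d i => //= d IH i.
by rewrite leq_min b_upper; have := IH i.+1; lia.
Qed.

Lemma colmax_lt q i : i.+1 < q -> colmax q i < colmax q i.+1.
Proof. by move=> iq; rewrite colmax_step //; have := colmax_ge q i.+1; lia. Qed.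

Lemma colmax_addn q i j : i <= j -> j < q -> colmax q i + (j - i) <= colmax q j.
Proof.
move=> ij; rewrite -{1 3}(subnKC ij); elim: (j - i) => [|d IH].
  by rewrite !addn0.
move=> /[dup] ?; rewrite !addnS => /colmax_lt; apply: leq_ltn_trans.
by apply: IH; lia.
Qed.

(** If the row below imposed the value, the step would be exactly one; so the bound of the row
    itself imposes it. *)
Lemma colmax_gap q i : i.+1 < q ->
  (colmax q i).+1 < colmax q i.+1 -> colmax q i = b i.
Proof. by move=> /colmax_step ->; lia. Qed.

(** This universal property serves to compare columns without computing minima. *)
Lemma colmax_greatest (f : nat -> nat) q :
    (forall i, i < q -> f i <= b i) ->
    (forall i, i.+1 < q -> f i < f i.+1) ->
  forall i, i < q -> f i <= colmax q i.
Proof.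
move=> fb f_lt i iq; rewrite /colmax; move eqd: (q.-1 - i) => d.
elim: d i iq eqd => [|d IH] i iq eqd /=; first exact: fb.
rewrite leq_min fb //=; have iq' : i.+1 < q by lia.
by have := IH i.+1 iq'; have := f_lt i iq'; lia.
Qed.

(** The first [q] rows of the longer column form a strict column within the bounds. *)
Lemma colmax_anti q q' i : i < q -> q <= q' -> colmax q' i <= colmax q i.
Proof.
move=> iq qq'; apply: colmax_greatest iq => [j _|j jq]; first exact: colmax_le.
exact/colmax_lt/(leq_trans jq).
Qed.

End ColumnMax.

(** * The largest tableau of a row bound set *)

Section RowBoundTableaux.

Variable n : nat.
Implicit Types (la : n.-tuple nat) (be ga : {ffun 'I_n -> 'I_n}) (T : tableau).

(** Outside ['I_n] the value [k] keeps the bounds upper at every natural number, as the column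
    lemmas require. *)
Definition bound be k : nat :=
  if insub k is Some x then val (be (x : 'I_n)) else k.

Lemma bound_ord be (i : 'I_n) : bound be i = be i.
Proof. by rewrite /bound valK. Qed.

Lemma bound_upper be k : upper be -> k <= bound be k.
Proof.
move=> /forallP be_up; rewrite /bound; case: insubP => // x _ <-; exact: be_up.
Qed.

Lemma bound_lt be k : k < n -> bound be k < n.
Proof. by move=> kn; rewrite -[k]/(val (Ordinal kn)) bound_ord. Qed.

Definition max_col be l := mkseq (colmax (bound be) l) l.
Definition max_tab la be := col_tab la (max_col be).

Lemma max_col_sorted be l : upper be -> sorted ltn (max_col be l).
Proof.
move=> up; apply/(sortedP 0) => i; rewrite size_mkseq => il.
by rewrite /= !nth_mkseq ?(ltnW il) // colmax_lt // => k; apply: bound_upper.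
Qed.

Lemma max_colP be l : upper be -> l <= n ->
  [/\ size (max_col be l) = l, all (fun x => x < n) (max_col be l)
    & sorted ltn (max_col be l)].
Proof.
move=> up ln; split; [exact: size_mkseq| |exact: max_col_sorted].
apply/allP => x /mapP[i]; rewrite mem_iota => il ->.
apply: leq_ltn_trans (colmax_le _ _ _) (bound_lt _ _); lia.
Qed.

Lemma max_tab_ssyt la be : upper be -> is_ssyt la (max_tab la be).
Proof.
move=> up; apply: col_tab_ssyt => [l /col_lengths_le|l l' _ _ l'l i il'].
  exact: max_colP.
rewrite !nth_mkseq ?(leq_trans il') //; apply: colmax_anti => // k.
exact: bound_upper.
Qed.

Lemma SsetP la be T :
  reflect (is_ssyt la T /\ forall C i, C \in T -> i < size C ->
             nth 0 C i <= bound be i)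
          (T \in Sset la be).
Proof.
rewrite /Sset in_fset inE in_tableaux; apply: (iffP andP) => -[sT H]; split=> //.
  move=> C i CT iC; have lt_in : i < n.
    exact: leq_trans iC (col_lengths_le (ssyt_size_mem sT CT)).
  have /forallP/(_ (Ordinal lt_in))/implyP/(_ iC) := allP H C CT.
  by rewrite -bound_ord.
apply/allP => C CT; apply/forallP => i; apply/implyP => iC.
by rewrite -bound_ord; apply: H.
Qed.

Lemma Sset_colmax la be T C i : T \in Sset la be -> C \in T -> i < size C ->
  nth 0 C i <= colmax (bound be) (size C) i.
Proof.
case/SsetP=> sT le_be CT.
apply: (@colmax_greatest _ _ (size C)) => [j jC|j jC]; first exact: le_be.
exact: sorted_ltn_nth_lt (ssyt_sorted_col sT CT) _ jC.
Qed.

Lemma Sset_le_max_tab la be T : T \in Sset la be -> tab_le T (max_tab la be).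
Proof.
move=> TS; have [sT _] := SsetP _ _ _ TS; have szT := ssyt_size sT.
apply/tab_leP; rewrite (size_map (max_col be)); split=> // [j jT|j i jT ij].
  by rewrite nth_col_tab -?szT // size_mkseq -(ssyt_size_col j sT).
rewrite nth_col_tab -?szT // -(ssyt_size_col j sT) nth_mkseq //.
by apply: Sset_colmax TS _ ij; rewrite mem_nth.
Qed.

Lemma max_tab_Sset la be : upper be -> max_tab la be \in Sset la be.
Proof.
move=> up; apply/SsetP; split; first exact: max_tab_ssyt.
move=> C i /mapP[l _ ->]; rewrite size_mkseq => il.
by rewrite nth_mkseq // colmax_le.
Qed.

(** With [Sset_le_max_tab], the row bound set is the whole order ideal below its maximum. *)
Lemma le_max_tab_Sset la be T : upper be -> is_ssyt la T ->
  tab_le T (max_tab la be) -> T \in Sset la be.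
Proof.
move=> up sT /tab_leP[szT sz_col le_T]; apply/SsetP; split=> // C i CT iC.
have [j jT eC] := nthP [::] CT; rewrite -eC in iC *.
apply: leq_trans (le_T _ _ jT iC) _.
have jla : j < size (col_lengths la) by rewrite -(ssyt_size sT).
rewrite nth_col_tab // nth_mkseq ?colmax_le //.
by rewrite -(ssyt_size_col j sT).
Qed.

(** All the entrywise maxima are attained by a single tableau of the set. *)
Lemma Qtab_max_tab la be : upper be -> Qtab la be = max_tab la be.
Proof.
move=> up; have maxS := max_tab_Sset la up.
apply: (@eq_from_nth _ [::]) => [|j]; first by rewrite !size_map size_iota.
rewrite size_map size_iota => jla.
have jC : j < size (col_lengths la) by rewrite size_col_lengths.
rewrite (nth_map 0) ?size_iota // nth_iota // add0n.
rewrite nth_col_tab //; set l := nth 0 _ j.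
apply: (@eq_from_nth _ 0) => [|i]; first by rewrite !size_map.
rewrite size_map size_iota => il.
rewrite (nth_map 0) ?size_iota // nth_iota // add0n nth_mkseq //.
apply/eqP; rewrite eqn_leq; apply/andP; split.
  apply/bigmax_leqP_seq => T TS _.
  have /tab_leP[szT sz_col le_T] := Sset_le_max_tab TS.
  have [sT _] := SsetP _ _ _ TS.
  have := le_T j i; rewrite (ssyt_size sT) (ssyt_size_col j sT) => /(_ jC il).
  by rewrite nth_col_tab // nth_mkseq.
have := @leq_bigmax_seq _ _ xpredT
  (fun T : tableau => nth 0 (nth [::] T j) i) _ maxS isT.
by rewrite nth_col_tab // nth_mkseq.
Qed.

End RowBoundTableaux.

(** * Key tableaux and the Demazure set *)

Lemma sorted_val_enum n (A : {pred 'I_n}) : sorted ltn [seq val x | x <- enum A].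
Proof.
apply: (subseq_sorted ltn_trans _ (iota_ltn_sorted 0 n)).
rewrite -val_enum_ord; apply: map_subseq.
by rewrite [X in subseq _ X]enumT /= filter_subseq.
Qed.

Section Keys.

Variables (n : nat) (la : n.-tuple nat) (pi : 'S_n).

Definition key_col l : seq nat := [seq val x | x <- enum (prefix_set pi l)].

Lemma mem_key_col l (x : 'I_n) : (val x \in key_col l) = (x \in prefix_set pi l).
Proof. by rewrite mem_map ?mem_enum //; apply: val_inj. Qed.

Lemma key_colP l : l <= n ->
  [/\ size (key_col l) = l, all (fun x => x < n) (key_col l)
    & sorted ltn (key_col l)].
Proof.
move=> ln; split; last exact: sorted_val_enum.
  rewrite size_map -cardE card_imset; last exact: perm_inj.
  rewrite cardE -(size_map val) (_ : map _ _ = iota 0 l) ?size_iota //.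
  apply: sorted_ltn_eq; rewrite ?iota_ltn_sorted ?sorted_val_enum // => x.
  rewrite mem_iota add0n /=; apply/mapP/idP => [[i + ->]|xl].
    by rewrite mem_enum inE.
  by exists (Ordinal (leq_trans xl ln)); first by rewrite mem_enum inE.
by apply/allP => _ /mapP[x _ ->]; apply: ltn_ord.
Qed.

Lemma key_col_nested l l' : l' <= l -> {subset key_col l' <= key_col l}.
Proof.
move=> l'l _ /mapP[x + ->]; rewrite mem_enum mem_key_col => /imsetP[i il' ->].
by apply: imset_f; move: il'; rewrite !inE => il'; apply: leq_trans il' l'l.
Qed.

Lemma Ytab_ssyt : is_ssyt la (Ytab la pi).
Proof.
apply: nested_ssyt => [l /col_lengths_le|l l' _ _]; first exact: key_colP.
exact: key_col_nested.
Qed.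

Lemma Ytab_right_key : right_key (Ytab la pi) = Ytab la pi.
Proof.
apply: nested_right_key => [l /col_lengths_le|l l' _ _]; first exact: key_colP.
exact: key_col_nested.
Qed.

Lemma in_Dset T :
  (T \in Dset la pi) = is_ssyt la T && tab_le (right_key T) (Ytab la pi).
Proof. by rewrite /Dset in_fset inE in_tableaux. Qed.

Lemma Ytab_Dset : Ytab la pi \in Dset la pi.
Proof. by rewrite in_Dset Ytab_ssyt Ytab_right_key tab_le_refl. Qed.

Lemma Dset_le_Ytab T : T \in Dset la pi -> tab_le T (Ytab la pi).
Proof.
rewrite in_Dset => /andP[/and4P[_ _ sT rT]]; apply: tab_le_trans.
exact: tab_le_right_key.
Qed.

Lemma min_tab_ssyt : is_ssyt la (min_tab la).
Proof. apply: nested_ssyt; [exact: iota_colP | exact: iota_nested]. Qed.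

(** The least tableau has nested columns, so it is its own right key. *)
Lemma min_tab_Dset : min_tab la \in Dset la pi.
Proof.
rewrite in_Dset min_tab_ssyt nested_right_key; last exact: iota_nested.
  exact/min_tab_le/Ytab_ssyt.
exact: iota_colP.
Qed.

End Keys.

(** * From equal polynomials to equal tableau sets *)

Lemma content_sumn n (la la' : n.-tuple nat) T U :
    is_ssyt la T -> is_ssyt la' U -> content n T = content n U ->
  sumn (flatten T) = sumn (flatten U).
Proof.
move=> /ssyt_flatten nT /ssyt_flatten nU e.
exact/perm_sumn/(content_perm nT nU e).
Qed.

Section PolynomialEquality.

Variables (n : nat) (la la' : n.-tuple nat).
Variables (be : {ffun 'I_n -> 'I_n}) (pi : 'S_n).
Hypotheses (pla : is_partition la) (pla' : is_partition la').
Hypothesis be_up : upper be.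
Hypothesis eq_poly : row_bound_sum la be = demazure_poly la' pi.

(* The least tableaux of both sets are the unique ones of least entry sum, so
   they have the same content, and that content is the shape. *)
Lemma poly_eq_shape : la = la'.
Proof.
have minS : min_tab la \in Sset la be.
  apply: le_max_tab_Sset (min_tab_ssyt _) _ => //.
  exact/min_tab_le/max_tab_ssyt.
have minD := min_tab_Dset la' pi.
have [T TD cT] := weight_sum_content eq_poly minS.
have [U US cU] := weight_sum_content (esym eq_poly) minD.
have sT : is_ssyt la' T by move: TD; rewrite in_Dset => /andP[].
have [sU _] := SsetP _ _ _ US.
have eT := content_sumn sT (min_tab_ssyt _) cT.
have eU := content_sumn sU (min_tab_ssyt _) cU.
have leT := min_tab_le sT; have leU := min_tab_le sU.
(* The two inequalities and the two equalities of contents close up into a cycle of entry sums, so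
   [T] has the least sum for its shape. *)
have TE : T = min_tab la'.
  symmetry; apply: tab_le_sumn_eq => //.
  have := tab_le_sumn leT; have := tab_le_sumn leU; lia.
apply/val_inj/(@eq_from_nth _ 0); first by rewrite !size_tuple.
move=> i; rewrite size_tuple => lt_in.
rewrite -!count_min_tab // -TE.
have /mnmP/(_ (Ordinal lt_in)) := cT; by rewrite !mnmE.
Qed.

End PolynomialEquality.

Section SameShape.

Variables (n : nat) (la : n.-tuple nat).
Variables (be : {ffun 'I_n -> 'I_n}) (pi : 'S_n).
Hypothesis be_up : upper be.
Hypothesis eq_poly : row_bound_sum la be = demazure_poly la pi.

(** As for the least tableaux, the entry sums of the two largest ones agree, hence so do their
    contents; a key is the only tableau of its shape and content. *)
Lemma poly_eq_max_tab : max_tab la be = Ytab la pi.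
Proof.
have maxS := max_tab_Sset la be_up; have maxD := Ytab_Dset la pi.
have [T TD cT] := weight_sum_content eq_poly maxS.
have [U US cU] := weight_sum_content (esym eq_poly) maxD.
have sT : is_ssyt la T by move: TD; rewrite in_Dset => /andP[].
have [sU _] := SsetP _ _ _ US.
have sQ := max_tab_ssyt la be_up.
have eT := content_sumn sT sQ cT.
have eU := content_sumn sU (Ytab_ssyt _ _) cU.
have leT := Dset_le_Ytab TD; have leU := Sset_le_max_tab US.
have TE : T = Ytab la pi.
  apply: tab_le_sumn_eq => //.
  have := tab_le_sumn leT; have := tab_le_sumn leU; lia.
apply: nested_unique => //.
- by move=> l /col_lengths_le; apply: key_colP.
- by move=> l l' _ _; apply: key_col_nested.
apply: content_perm (ssyt_flatten sQ) (ssyt_flatten (Ytab_ssyt _ _)) _.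
by rewrite -cT TE.
Qed.

(** A tableau of [Dset] lies below [Ytab], now the maximum of [Sset]; this inclusion and the equal
    polynomials give equality. *)
Lemma poly_eq_set : Sset la be = Dset la pi.
Proof.
symmetry; apply: weight_sum_fsubset_eq (esym eq_poly) _ => T TD.
apply: le_max_tab_Sset => //; first by move: TD; rewrite in_Dset => /andP[].
by rewrite poly_eq_max_tab; apply: Dset_le_Ytab.
Qed.

End SameShape.

(** * Carrels and critical indices *)

Lemma sorted_val_filter n (p : pred 'I_n) :
  sorted ltn [seq val i | i <- [seq i <- enum 'I_n | p i]].
Proof.
apply: (subseq_sorted ltn_trans _ (iota_ltn_sorted 0 n)).
by rewrite -val_enum_ord; apply/map_subseq/filter_subseq.
Qed.

Lemma filter_ord_rcons n (a b : nat) (bn : b < n) : a <= b ->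
  [seq i : 'I_n <- enum 'I_n | a <= i < b.+1] =
  rcons [seq i : 'I_n <- enum 'I_n | a <= i < b] (Ordinal bn).
Proof.
move=> ab; apply: (inj_map val_inj); rewrite map_rcons.
have H c : c <= n -> map val [seq i : 'I_n <- enum 'I_n | a <= i < c] =
    [seq i <- iota 0 c | a <= i].
  move=> cn; apply: sorted_ltn_eq; first exact: sorted_val_filter.
    by apply: sorted_filter (iota_ltn_sorted _ _) => x y z; apply: ltn_trans.
  move=> x; rewrite mem_filter mem_iota add0n; apply/mapP/idP => [[i + ->]|ax].
    by rewrite mem_filter => /andP[].
  have xn : x < n by case/andP: ax => _ /leq_trans; apply.
  by exists (Ordinal xn); rewrite // mem_filter mem_enum ax.
by rewrite !H ?(ltnW bn) // -addn1 iotaD filter_cat /= ab cats1.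
Qed.

Lemma filter_ord_cat n (a b c : nat) : a <= b <= c -> c <= n ->
  [seq i : 'I_n <- enum 'I_n | a <= i < b] ++
  [seq i : 'I_n <- enum 'I_n | b <= i < c] =
  [seq i : 'I_n <- enum 'I_n | a <= i < c].
Proof.
case/andP=> ab bc; rewrite -(subnKC bc); elim: (c - b) => [|d IH] dn.
  rewrite addn0 (@eq_filter _ (fun i : 'I_n => b <= i < b) pred0) => [|i /=].
    by rewrite filter_pred0 cats0.
  lia.
rewrite addnS in dn *; rewrite !(filter_ord_rcons dn) ?leq_addr //.
  by rewrite -rcons_cat IH // ltnW.
exact: leq_trans ab (leq_addr _ _).
Qed.

Lemma pairwise_sorted_val n (r : rel 'I_n) (s : seq 'I_n) :
    sorted ltn (map val s) ->
  reflect {in s &, forall x y : 'I_n, x < y -> r x y} (pairwise r s).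
Proof.
elim: s => [|x s IH] /=; first by constructor.
rewrite path_sortedE; last exact: ltn_trans.
case/andP=> /allP lt_x /IH{}IH; apply: (iffP andP) => [[/allP rx /IH rs]|rs].
  move=> y z; rewrite !inE => /orP[/eqP->|ys] /orP[/eqP->|zs].
  - by rewrite ltnn.
  - by move=> _; apply: rx.
  - by move=> yx; have xy : x < y := lt_x _ (map_f val ys); lia.
  - exact: rs.
split; first apply/allP => y ys.
  by apply: rs; rewrite ?inE ?eqxx ?ys ?orbT //; apply/lt_x/map_f.
by apply/IH => y z ys zs; apply: rs; rewrite inE ?ys ?zs orbT.
Qed.

Section CarrelTheory.

Variables (n : nat) (la : n.-tuple nat).
Hypothesis n_gt0 : 0 < n.

Notation rs := (0 :: rcons (Rset la) n).

Lemma mem_Rset q : (q \in Rset la) = (0 < q < n) && (q \in col_lengths la).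
Proof. by rewrite mem_filter mem_iota add1n prednK // andbC. Qed.

Lemma Rset_sorted : sorted ltn rs.
Proof.
have sR : sorted ltn (Rset la).
  by apply: sorted_filter (iota_ltn_sorted _ _) => x y z; apply: ltn_trans.
rewrite /= rcons_path path_sortedE; last exact: ltn_trans.
rewrite sR andbT; apply/andP; split.
  by apply/allP => q; rewrite mem_Rset => /andP[/andP[]].
have := mem_last 0 (Rset la); rewrite inE => /orP[/eqP->//|].
by rewrite mem_Rset => /andP[/andP[]].
Qed.

Lemma qq_last : qq la (rnum la).+1 = n.
Proof. by rewrite /qq /= nth_rcons ltnn eqxx. Qed.

Lemma qq_default h : rnum la < h -> qq la h = n.
Proof.
case: (ltngtP h (rnum la).+1) => // [lt_h|->] _.
  by rewrite /qq nth_default //= size_rcons.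
exact: qq_last.
Qed.

Lemma qq_lt h : h <= rnum la -> qq la h < qq la h.+1.
Proof.
move=> hr; apply: (sorted_ltn_nth ltn_trans n Rset_sorted) => //.
  by rewrite inE /= size_rcons ltnS leqW.
by rewrite inE /= size_rcons !ltnS.
Qed.

(** Past the last carrel [qq] is constantly [n], the default of its [nth], so monotonicity holds for
    all indices. *)
Lemma qq_le h h' : h <= h' -> qq la h <= qq la h'.
Proof.
move=> hh'; rewrite -(subnKC hh'); elim: (h' - h) => [|d IH].
  by rewrite addn0.
rewrite addnS; apply: leq_trans IH _.
case: (leqP (h + d) (rnum la)) => [/qq_lt/ltnW //|lt_r].
by rewrite !qq_default // leqW.
Qed.

Lemma qq_le_n h : qq la h <= n.
Proof.
by rewrite -[X in _ <= X](qq_default (leq_maxr h (rnum la).+1)) qq_le // leq_maxl.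
Qed.

Lemma carrel_ofP (i : 'I_n) :
  [/\ 0 < carrel_of la i <= (rnum la).+1, qq la (carrel_of la i).-1 <= i
    & i < qq la (carrel_of la i)].
Proof.
have hasi : has (fun q => i < q) rs.
  by apply/hasP; exists n; rewrite // inE mem_rcons inE eqxx orbT.
have lt_i : i < qq la (carrel_of la i) by apply: (nth_find n hasi).
(* The leading 0 of the list never exceeds [i], so [find] returns a positive position. *)
have h_gt0 : 0 < carrel_of la i by case: (carrel_of la i) lt_i.
split=> //.
  by rewrite h_gt0 /=; move: hasi; rewrite has_find /= size_rcons ltnS.
rewrite leqNgt; apply/negbT/(before_find n); rewrite -/(carrel_of la i).
by rewrite prednK.
Qed.

Lemma carrel_of_eq h (i : 'I_n) :
  0 < h -> qq la h.-1 <= i < qq la h -> carrel_of la i = h.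
Proof.
move=> h_gt0 /andP[le_i lt_i]; have [h'_gt0 le'_i lt'_i] := carrel_ofP i.
case: (ltngtP (carrel_of la i) h) => // lt_h.
  have := @qq_le (carrel_of la i) h.-1; lia.
have := @qq_le h (carrel_of la i).-1; lia.
Qed.

Lemma carrel_of_le (i k : 'I_n) : i <= k -> carrel_of la i <= carrel_of la k.
Proof.
move=> ik; rewrite leqNgt; apply/negP => lt_h.
have [_ _ lt_k] := carrel_ofP k; have [_ le_i _] := carrel_ofP i.
have := @qq_le (carrel_of la k) (carrel_of la i).-1; lia.
Qed.

Lemma mem_carrel h (i : 'I_n) : 0 < h ->
  (i \in carrel la h) = (carrel_of la i == h).
Proof.
move=> h_gt0; rewrite mem_filter mem_enum andbT; apply/idP/eqP.
  exact: carrel_of_eq.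
by move=> <-; have [_ -> ->] := carrel_ofP i.
Qed.

(** As indices start from 0, this is one past the last index of the carrel. *)
Definition cend (i : 'I_n) := qq la (carrel_of la i).

Lemma cend_gt (i : 'I_n) : i < cend i. Proof. by have [] := carrel_ofP i. Qed.

(** Column lengths are ends of carrels, so a column that reaches row [i] contains the rest of its
    carrel. *)
Lemma cend_le (i : 'I_n) l : l \in col_lengths la -> i < l -> cend i <= l.
Proof.
move=> lC il; have ln := col_lengths_le lC.
case: (ltngtP l n) ln => // [ltn _|-> _]; last exact: qq_le_n.
have : l \in Rset la by rewrite mem_Rset ltn lC (leq_ltn_trans _ il).
move=> /(nthP n)[h hr el]; have {}el : qq la h.+1 = l.
  by rewrite /qq /= nth_rcons hr.
rewrite -el; apply: qq_le; rewrite leqNgt; apply/negP => lt_h.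
have [_ le_i _] := carrel_ofP i.
have := @qq_le h.+1 (carrel_of la i).-1; lia.
Qed.

Lemma qq_col_lengths h : 0 < h <= rnum la -> qq la h \in col_lengths la.
Proof.
case: h => // h /= hr; rewrite /qq /= nth_rcons hr.
by have := mem_nth n hr; rewrite mem_Rset => /andP[].
Qed.

Lemma carrel_rcons h : 0 < h <= (rnum la).+1 -> exists x : 'I_n,
  [/\ x.+1 = qq la h, carrel_of la x = h
    & carrel la h = rcons [seq i : 'I_n <- enum 'I_n | qq la h.-1 <= i < x] x].
Proof.
case/andP=> h_gt0 h_le; have lt_q : qq la h.-1 < qq la h.
  by rewrite -[X in _ < qq la X](prednK h_gt0) qq_lt //; lia.
have pn : (qq la h).-1 < n by have := qq_le_n h; lia.
exists (Ordinal pn); split; first by rewrite /= prednK //; lia.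
  by apply: carrel_of_eq => //=; lia.
by rewrite /= -filter_ord_rcons ?prednK //; lia.
Qed.

(** * Critical indices as jumps of the largest columns *)

Section Critical.

Variable be : {ffun 'I_n -> 'I_n}.
Hypothesis be_up : upper be.

Let b_up k : k <= bound be k. Proof. exact: bound_upper. Qed.

Notation cmax := (colmax (bound be)).

(** A local substitute for the recursive search: the last row, and each row after which the largest
    column of length [q] skips a value. *)
Definition critical_row q i := (i.+1 == q) || ((cmax q i).+1 < cmax q i.+1).

Definition critical (i : 'I_n) := critical_row (cend i) i.

Lemma critical_colmax q i : critical_row q i -> i < q -> cmax q i = bound be i.
Proof.
move=> /orP[/eqP<- _|/[dup] gap _ iq]; first exact: colmax_last.
have [e|ne] := eqVneq i.+1 q; first by rewrite -e colmax_last.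
by apply: colmax_gap gap => //; lia.
Qed.

(** The equation is the invariant of the search: from row [N] to the last critical index found, [x],
    the largest column rises by one per row. *)
Lemma crit_below_colmax q a N (x : 'I_n) : N <= x -> x < q ->
    cmax q N + (x - N) = be x ->
  crit_below be x (rev [seq i : 'I_n <- enum 'I_n | a <= i < N]) =
  rev [seq i : 'I_n <- [seq i : 'I_n <- enum 'I_n | a <= i < N]
      | critical_row q i].
Proof.
elim: N x => [|N IH] x Nx xq e.
  rewrite (@eq_filter _ _ pred0) ?filter_pred0 // => i /=; lia.
case: (leqP a N) => [aN|Na]; last first.
  rewrite (@eq_filter _ _ pred0) ?filter_pred0 // => i /=; lia.
have Nn : N < n by apply: ltn_trans (ltn_ord x).
rewrite (filter_ord_rcons Nn aN) rev_rcons filter_rcons /=.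
have Nq : N.+1 < q by lia.
have stepN := colmax_step (bound be) Nq.
have geN := colmax_ge b_up q N.+1.
(* By the invariant, the test compares the successor of the bound at [N] with the entry of row
   [N.+1], so it detects a skipped value. *)
have -> : (x - N < be x - be (Ordinal Nn)) = critical_row q N.
  by rewrite -(bound_ord be (Ordinal Nn)) -e /critical_row /=; lia.
case: ifP => [cN|/negbT ncN]; last first.
  apply: IH => //; first by lia.
  by rewrite -e; move: ncN; rewrite /critical_row; lia.
rewrite rev_rcons IH //=; first by lia.
by rewrite subnn addn0 critical_colmax ?bound_ord // ?(ltnW Nq) // -bound_ord.
Qed.

Lemma crit_filter h : 0 < h <= (rnum la).+1 ->
  crit la be h = [seq i <- carrel la h | critical i].
Proof.
move=> hP; have [x [eq_x _ car]] := carrel_rcons hP.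
transitivity [seq i : 'I_n <- carrel la h | critical_row (qq la h) i].
  rewrite /crit car rev_rcons (@crit_below_colmax (qq la h)) ?eq_x //; last first.
    by rewrite subnn addn0 -bound_ord -eq_x colmax_last.
  by rewrite rev_cons revK filter_rcons /critical_row eq_x eqxx.
apply: eq_in_filter => i; rewrite mem_carrel; last by case/andP: hP.
by rewrite /critical /cend => /eqP ->.
Qed.

Lemma mem_crit (i x : 'I_n) : (x \in crit la be (carrel_of la i)) =
  (carrel_of la x == carrel_of la i) && critical x.
Proof.
have [h_le _ _] := carrel_ofP i.
by rewrite crit_filter // mem_filter mem_carrel 1?andbC //; case/andP: h_le.
Qed.

Lemma critical_last (i : 'I_n) : i.+1 = cend i -> critical i.
Proof. by move=> e; rewrite /critical /critical_row e eqxx. Qed.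

Lemma cend_last (i : 'I_n) : exists2 x : 'I_n,
  x.+1 = cend i & [/\ i <= x, carrel_of la x = carrel_of la i & critical x].
Proof.
have [h_le _ _] := carrel_ofP i; have [x [eq_x eh _]] := carrel_rcons h_le.
exists x => //; split=> //; first by have := cend_gt i; rewrite /cend -eq_x.
by apply: critical_last; rewrite eq_x /cend eh.
Qed.

Lemma next_critP (i : 'I_n) : let x := next_crit la be i in
  [/\ i <= x, carrel_of la x = carrel_of la i, critical x
    & forall k : 'I_n, i <= k -> carrel_of la k = carrel_of la i -> critical k -> x <= k].
Proof.
rewrite /next_crit; set s := [seq _ <- _ | _].
have ms k : (k \in s) = [&& i <= k, carrel_of la k == carrel_of la i & critical k].
  by rewrite mem_filter mem_crit.
have ss : sorted ltn (map val s).
  apply: (subseq_sorted ltn_trans _ (iota_ltn_sorted 0 n)).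
  rewrite -val_enum_ord; apply: map_subseq; apply: subseq_trans (filter_subseq _ _) _.
  have [h_le _ _] := carrel_ofP i; rewrite crit_filter //.
  exact: subseq_trans (filter_subseq _ _) (filter_subseq _ _).
have [y _ [iy eh cy]] := cend_last i.
have : y \in s by rewrite ms iy eh eqxx cy.
case: s ms ss => // x s ms ss _; rewrite [head _ _]/=.
have := ms x; rewrite mem_head => /esym/and3P[ix /eqP ehx cx]; split=> // k ik ehk ck.
have : k \in x :: s by rewrite ms ik ehk eqxx ck.
rewrite inE => /orP[/eqP-> //|ks].
have := order_path_min ltn_trans ss => /allP/(_ _ (map_f val ks)); exact: ltnW.
Qed.

(** No value is skipped between [i] and the next critical index, where the column attains its
    bound. *)
Lemma next_crit_colmax (i : 'I_n) (x := next_crit la be i) :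
  cmax (cend i) i + (x - i) = be x.
Proof.
have [ix eh cx minx] := next_critP i; rewrite -/x in ix eh cx minx.
have xq : x < cend i by rewrite /cend -eh; apply: cend_gt.
rewrite -bound_ord -(@critical_colmax (cend i)) //; last first.
  by move: cx; rewrite /critical /cend eh.
have H d : i + d <= x -> cmax (cend i) (i + d) = cmax (cend i) i + d.
  elim: d => [|d IH]; first by rewrite !addn0.
  rewrite addnS => lt_x; have kn : i + d < n by apply: ltn_trans (ltn_ord x).
  have ehk : carrel_of la (Ordinal kn) = carrel_of la i.
    have := @carrel_of_le i (Ordinal kn); have := @carrel_of_le (Ordinal kn) x.
    rewrite /= eh; lia.
  have /contra := minx (Ordinal kn) (leq_addr _ _) ehk.
  rewrite -ltnNge => /(_ lt_x); rewrite /critical /critical_row /cend ehk -/(cend i) /=.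
  have := @colmax_lt _ b_up (cend i) (i + d); rewrite IH ?(ltnW lt_x) //; lia.
by rewrite -{2}(subnKC ix) H ?subnKC.
Qed.

(** From here on [Delta] is handled through columns: on a carrel it consists of the last rows of the
    largest column ending there. *)
Lemma Delta_colmax (i : 'I_n) : Delta la be i = cmax (cend i) i :> nat.
Proof. by rewrite ffunE /= -next_crit_colmax addnK. Qed.

Lemma critical_indices_filter :
  critical_indices la be = [seq i <- enum 'I_n | critical i].
Proof.
have H m : m <= (rnum la).+1 ->
    flatten [seq crit la be h | h <- iota 1 m] =
    [seq i : 'I_n <- [seq i : 'I_n <- enum 'I_n | 0 <= i < qq la m] | critical i].
  elim: m => [|m IH] mr.
    rewrite (@eq_filter _ (fun i : 'I_n => 0 <= i < qq la 0) pred0) //.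
    by rewrite filter_pred0.
  rewrite -{1}[m.+1]addn1 iotaD map_cat flatten_cat IH ?(ltnW mr) //.
  rewrite [flatten (map _ (iota (1 + m) 1))]/= cats0 add1n.
  rewrite crit_filter ?mr // -filter_cat /carrel [m.+1.-1]/= filter_ord_cat //.
    by rewrite qq_le.
  exact: qq_le_n.
rewrite /critical_indices H // qq_last; congr filter.
by apply/all_filterP/allP => i _ /=.
Qed.

Lemma UGCP : reflect
  (forall i k : 'I_n, i <= k -> critical i -> critical k -> be i <= be k)
  (UGC la be).
Proof.
rewrite /UGC be_up /= critical_indices_filter.
rewrite (sorted_pairwise leq_trans) pairwise_map.
apply: (iffP (pairwise_sorted_val _ (sorted_val_filter _))) => H i k.
  rewrite leq_eqVlt => /orP[/eqP/val_inj-> //|ik ci ck].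
  by apply: H ik; rewrite mem_filter mem_enum andbT.
by rewrite !mem_filter => /andP[ci _] /andP[ck _] /ltnW ik; apply: H.
Qed.

End Critical.
End CarrelTheory.

(** * Row bound sets and flags *)

Section RowBounds.

Variables (n : nat) (la : n.-tuple nat).
Hypothesis n_gt0 : 0 < n.

Lemma cend_mono (i k : 'I_n) : k < cend la i -> cend la k <= cend la i.
Proof.
move=> ki; apply: qq_le => //; rewrite leqNgt; apply/negP => lt_h.
have [_ le_k _] := carrel_ofP la k.
have := @qq_le _ la n_gt0 (carrel_of la i) (carrel_of la k).-1.
rewrite -/(cend la i); lia.
Qed.

Section Bound.

Variable be : {ffun 'I_n -> 'I_n}.
Hypothesis be_up : upper be.

Let b_up k : k <= bound be k. Proof. exact: bound_upper. Qed.

Notation cmax := (colmax (bound be)).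
Notation crit_row := (critical la be).

Lemma critical_eq (i : 'I_n) : crit_row i -> cmax (cend la i) i = be i.
Proof.
by move=> ci; rewrite (critical_colmax n_gt0 be_up ci) ?bound_ord //; apply: cend_gt.
Qed.

Lemma colmax_carrel_lt (i k : 'I_n) : carrel_of la i = carrel_of la k ->
  i < k -> cmax (cend la i) i < cmax (cend la k) k.
Proof.
move=> eh ik; rewrite /cend eh -/(cend la k).
have := @colmax_addn _ b_up (cend la k) i k (ltnW ik) (cend_gt _ _); lia.
Qed.

(** Only bounds at critical indices matter. A column reaching row [i] reaches the next critical
    index [x] too, and strictness carries the bound at [x] up to row [i], where it becomes the entry
    of the largest column. *)
Lemma Sset_eq_row_bounds (phi : {ffun 'I_n -> 'I_n}) :
    (forall i : 'I_n, cmax (cend la i) i <= phi i) ->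
    (forall i : 'I_n, crit_row i -> phi i <= be i) ->
  Sset la be = Sset la phi.
Proof.
move=> le_phi phi_le; apply/fsetP => T; apply/idP/idP => TS.
  have [sT _] := SsetP _ _ _ TS; apply/SsetP; split=> // C i CT iC.
  have CC := ssyt_size_mem sT CT.
  have lt_in : i < n := leq_trans iC (col_lengths_le CC).
  apply: leq_trans (Sset_colmax TS CT iC) _.
  rewrite -[i]/(val (Ordinal lt_in)) bound_ord; apply: leq_trans (le_phi _).
  apply: colmax_anti => //; first exact: cend_gt.
  exact: cend_le.
have [sT leT] := SsetP _ _ _ TS; apply/SsetP; split=> // C i CT iC.
have CC := ssyt_size_mem sT CT.
have lt_in : i < n := leq_trans iC (col_lengths_le CC).
pose o := Ordinal lt_in; have := next_crit_colmax la n_gt0 be_up o.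
have [ox eh cx _] := next_critP la n_gt0 be_up o.
set x := next_crit la be o in ox eh cx *.
have xC : x < size C.
  apply: leq_trans (cend_gt la x) _; rewrite /cend eh; exact: cend_le.
have : nth 0 C i + (x - i) <= nth 0 C x.
  rewrite -{2}(subnKC ox) /=; have : i + (x - i) < size C by rewrite subnKC.
  elim: (x - i) => [|d IH]; rewrite ?addn0 // !addnS => dC.
  apply: leq_ltn_trans (IH (ltnW dC)) _.
  by apply: sorted_ltn_nth_lt dC; rewrite // (ssyt_sorted_col sT CT).
have := leT C x CT xC; rewrite bound_ord; have := phi_le x cx.
have := colmax_le (bound be) (cend la o) i; rewrite /=; lia.
Qed.

Lemma upper_Delta : upper (Delta la be).
Proof. by apply/forallP => i; rewrite Delta_colmax // colmax_ge. Qed.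

(** [Delta] lies below [be], yet at each index [j] above the largest columns that end at or after
    the carrel of [j]. *)
Lemma colmax_Delta (i : 'I_n) k : k < cend la i ->
  colmax (bound (Delta la be)) (cend la i) k = cmax (cend la i) k.
Proof.
have D_up j : j <= bound (Delta la be) j by apply/bound_upper/upper_Delta.
have D_eq j (jn : j < n) :
    bound (Delta la be) j = cmax (cend la (Ordinal jn)) j.
  by rewrite -[LHS]/(bound _ (val (Ordinal jn))) bound_ord Delta_colmax.
have qn : cend la i <= n by apply: qq_le_n.
move=> ki; apply/eqP; rewrite eqn_leq; apply/andP; split.
  apply: colmax_greatest ki => // j ji; last exact: colmax_lt.
  apply: leq_trans (colmax_le _ _ _) _.
  by rewrite (D_eq j (leq_trans ji qn)) colmax_le.
apply: colmax_greatest ki => // j ji; last exact: colmax_lt.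
rewrite (D_eq j (leq_trans ji qn)); apply: colmax_anti => //.
  by rewrite -[X in X < _]/(val (Ordinal (leq_trans ji qn))) cend_gt.
exact: cend_mono.
Qed.

Lemma critical_Delta (i : 'I_n) : critical la (Delta la be) i = crit_row i.
Proof.
rewrite /critical /critical_row; case: eqP => //= ne.
have := cend_gt la i => lt_i.
by rewrite !colmax_Delta //; lia.
Qed.

Lemma UG_Delta : UGC la be -> UG la (Delta la be).
Proof.
have D_up := upper_Delta.
move=> /(UGCP la n_gt0 be_up) ugc; apply/andP; split.
  apply/UGCP => // i k ik; rewrite !critical_Delta => ci ck.
  by rewrite !Delta_colmax // !critical_eq // ugc.
apply/andP; split=> //; apply/forallP => i; apply/forallP => k.
by apply/implyP => /andP[/eqP eh ik]; rewrite !Delta_colmax // colmax_carrel_lt.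
Qed.

(** This is the first argument of the maximum in [Phi]; 0 stands for no constraint in the first
    carrel. *)
Definition carrel_floor (i : 'I_n) : nat :=
  if 1 < carrel_of la i then val (be (last i (carrel la (carrel_of la i).-1))) else 0.

Lemma carrel_floorP (i : 'I_n) : 1 < carrel_of la i -> exists e : 'I_n,
  [/\ e.+1 = qq la (carrel_of la i).-1, crit_row e, e < i & carrel_floor i = be e].
Proof.
move=> h_gt1; have [h_le le_i _] := carrel_ofP la i.
have [|e [eq_e eh car]] := @carrel_rcons _ la n_gt0 (carrel_of la i).-1.
  by lia.
exists e; rewrite /carrel_floor h_gt1 car last_rcons; split=> //.
  by apply: critical_last; rewrite eq_e /cend eh.
by rewrite eq_e.
Qed.

Lemma carrel_floor_eq (i k : 'I_n) :
  carrel_of la i = carrel_of la k -> carrel_floor i = carrel_floor k.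
Proof.
move=> eh; rewrite /carrel_floor eh; case: ifP => // h_gt1.
have [h_le _ _] := carrel_ofP la k.
have [|e [_ _ ->]] := @carrel_rcons _ la n_gt0 (carrel_of la k).-1; first by lia.
by rewrite !last_rcons.
Qed.

Hypothesis ugc : UGC la be.

Lemma UGC_le (i k : 'I_n) : i <= k -> crit_row i -> crit_row k -> be i <= be k.
Proof. by move: i k; apply/UGCP. Qed.

Lemma carrel_floor_le (i : 'I_n) : crit_row i -> carrel_floor i <= be i.
Proof.
move=> ci; case: (ltnP 1 (carrel_of la i)) => [/carrel_floorP[e [_ ce ei ->]]|].
  exact: UGC_le (ltnW ei) ce ci.
by rewrite /carrel_floor ltnNge => ->.
Qed.

(** The cases of [Phi] merge: at a critical index, and beyond the first one of a carrel, the floor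
    is at most the column entry because critical entries increase. *)
Lemma Phi_maxn (i : 'I_n) :
  Phi la be i = maxn (carrel_floor i) (cmax (cend la i) i) :> nat.
Proof.
have [ix eh cx minx] := next_critP la n_gt0 be_up i.
have ex := next_crit_colmax la n_gt0 be_up i.
rewrite ffunE /= mem_crit // eqxx /=.
set x := next_crit la be i in ix eh cx minx ex *.
have sub_x : ord_sub (be x) (x - i) = cmax (cend la i) i :> nat.
  by rewrite /= -ex addnK.
case: ifP => [ci|/negbT nci].
  by rewrite critical_eq //; have := carrel_floor_le ci; lia.
case: ifP => [/andP[h_gt1 _]|].
  rewrite /carrel_floor h_gt1 -sub_x.
  set u := be _; set v := ord_sub _ _.
  by rewrite Order.POrderTheory.maxEle leEord; case: leqP; lia.
rewrite sub_x => /negbT; rewrite negb_and => /orP[h_le1|ne_x].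
  by rewrite /carrel_floor (negbTE h_le1) max0n.
have : x \in crit la be (carrel_of la i) by rewrite mem_crit // eh eqxx.
set s := crit la be _ in ne_x *; have ss : sorted ltn (map val s).
  have [h_le _ _] := carrel_ofP la i; rewrite /s crit_filter //.
  have := sorted_val_filter (fun k => critical la be k &&
    (qq la (carrel_of la i).-1 <= k < qq la (carrel_of la i))).
  by rewrite filter_predI.
have ms k : (k \in s) = (carrel_of la k == carrel_of la i) && crit_row k.
  by rewrite mem_crit.
case: s ms ss ne_x => // y s ms ss /= ne_x; rewrite inE (negbTE ne_x) /= => xs.
have /andP[/eqP ehy cy] : (carrel_of la y == carrel_of la i) && crit_row y.
  by rewrite -ms mem_head.
have yx : y < x by have /allP/(_ _ (map_f val xs)) := order_path_min ltn_trans ss.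
(* [x] is the first critical index from [i] on, so the first one of the carrel, [y], comes before
   [i]. *)
have yi : y < i.
  by rewrite ltnNge; apply/negP => /minx/(_ ehy cy); lia.
have := colmax_carrel_lt ehy yi; rewrite critical_eq //.
have := carrel_floor_le cy; rewrite (carrel_floor_eq ehy); lia.
Qed.

(** Inside a carrel the floor is constant and the column increases. Across carrels, everything
    before is at most the critical entry ending its carrel, hence at most the floor of the later
    carrel. *)
Lemma UF_Phi : UF (Phi la be).
Proof.
apply/andP; split.
  apply/forallP => i; rewrite Phi_maxn.
  by have := colmax_ge b_up (cend la i) i; lia.
apply/forallP => i; apply/forallP => k; apply/implyP => ik; rewrite !Phi_maxn.
have := carrel_of_le la n_gt0 ik; rewrite leq_eqVlt => /orP[/eqP eh|lt_h].
  rewrite (carrel_floor_eq eh); move: ik; rewrite leq_eqVlt.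
  case/orP=> [/eqP/val_inj-> //|ik].
  by have := colmax_carrel_lt eh ik; lia.
have [h_gt0 _ _] := carrel_ofP la i.
have [|e [eq_e ce ek ->]] := @carrel_floorP k; first by lia.
have [f eq_f [lef ehf cf]] := cend_last la n_gt0 be i.
have fe : f <= e.
  by rewrite -ltnS eq_f eq_e; apply: qq_le => //; lia.
have le_fe := UGC_le fe cf ce.
have le_if : cmax (cend la i) i <= be f.
  rewrite -critical_eq // {2}/cend ehf -/(cend la i).
  by have := colmax_addn b_up lef (leq_trans (leqnn _) (eq_leq eq_f)); lia.
have := carrel_floor_le cf; rewrite (carrel_floor_eq ehf); lia.
Qed.

Lemma Sset_Phi : Sset la be = Sset la (Phi la be).
Proof.
apply: Sset_eq_row_bounds => i; first by rewrite Phi_maxn leq_maxr.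
by move=> ci; rewrite Phi_maxn critical_eq //; have := carrel_floor_le ci; lia.
Qed.

End Bound.

Lemma Sset_Delta (be : {ffun 'I_n -> 'I_n}) :
  upper be -> Sset la be = Sset la (Delta la be).
Proof.
move=> be_up; apply: Sset_eq_row_bounds => // i; rewrite Delta_colmax //.
by move=> ci; rewrite critical_eq.
Qed.

End RowBounds.

(** * Consequences of the equality of the tableau sets *)

Lemma sorted_ltn_iota n (C : seq nat) :
  sorted ltn C -> all (fun x => x < n) C -> size C = n -> C = iota 0 n.
Proof.
move=> sC /allP nC szC; apply: sorted_ltn_subset_eq => //.
- exact: iota_ltn_sorted.
- by move=> x /nC; rewrite mem_iota.
by rewrite size_iota szC.
Qed.

Section EqualSets.

Variables (n : nat) (la : n.-tuple nat).
Hypothesis n_gt0 : 0 < n.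
Variables (be : {ffun 'I_n -> 'I_n}) (pi : 'S_n).
Hypothesis be_up : upper be.
Hypothesis eq_max : max_tab la be = Ytab la pi.
Hypothesis eq_set : Sset la be = Dset la pi.

Let b_up k : k <= bound be k. Proof. exact: bound_upper. Qed.

Notation cmax := (colmax (bound be)).
Notation crit_row := (critical la be).

Lemma max_col_key l : l \in col_lengths la -> max_col be l = key_col pi l.
Proof. by move=> lC; have /eq_in_map/(_ l lC) := eq_max. Qed.

Lemma max_col_key_qq h : 0 < h -> max_col be (qq la h) = key_col pi (qq la h).
Proof.
move=> h_gt0; case: (leqP h (rnum la)) => [hr|/qq_default ->].
  by rewrite max_col_key // qq_col_lengths // h_gt0.
(* The length [n] need not occur in the shape, but a strict column of that length contains all
   values. *)
have [s1 a1 o1] := max_colP be_up (leqnn n).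
have [s2 a2 o2] := key_colP pi (leqnn n).
by rewrite (sorted_ltn_iota o1 a1 s1) (sorted_ltn_iota o2 a2 s2).
Qed.

Lemma mem_max_col h (x : 'I_n) : 0 < h ->
  (val (pi x) \in max_col be (qq la h)) = (x < qq la h).
Proof.
move=> h_gt0; rewrite max_col_key_qq // mem_key_col mem_imset ?inE //.
exact: perm_inj.
Qed.

Lemma max_col_nested h : 0 < h ->
  {subset max_col be (qq la h) <= max_col be (qq la h.+1)}.
Proof.
move=> h_gt0; rewrite !max_col_key_qq //; apply/key_col_nested.
exact: qq_le.
Qed.

(* If the columns of length [q] are bounded by [z] in their last row, the
   largest tableau still contains the column [max_col be q'], so its right key
   exceeds [Ytab] there unless [z] is one of the entries of that column. *)
Lemma lowered_bound_mem q q' (e z : 'I_n) :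
    q \in col_lengths la -> q' \in col_lengths la -> q < q' -> e.+1 = q ->
    cmax q' e <= z -> z <= be e -> val z \in max_col be q'.
Proof.
move=> qC q'C lt_q eq_e le_z z_le; apply/contraT => z_notin.
pose be' : {ffun 'I_n -> 'I_n} := [ffun i => if i == e then z else be i].
have le_be' (i : 'I_n) : be' i <= be i by rewrite ffunE; case: eqP => [->|].
have le_bound k : k < n -> bound be' k <= bound be k.
  by move=> kn; rewrite -[k]/(val (Ordinal kn)) !bound_ord.
have be'_up : upper be'.
  apply/forallP => i; rewrite ffunE; case: eqP => [->|_].
    exact: leq_trans (colmax_ge b_up _ _) le_z.
  by rewrite -bound_ord.
have b'_up k : k <= bound be' k by apply: bound_upper.
pose T := max_tab la be'.
have TS : T \in Sset la be.
  have [sT leT] := SsetP _ _ _ (max_tab_Sset la be'_up).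
  apply/SsetP; split=> // C i CT iC; apply: leq_trans (leT C i CT iC) (le_bound _ _).
  exact: leq_trans iC (col_lengths_le (ssyt_size_mem sT CT)).
(* The longer column already has an entry at most [z] in row [e], so the lowered bound does not
   affect it. *)
have col_q' : max_col be' q' = max_col be q'.
  apply/eq_in_map => i; rewrite mem_iota add0n => /= iq'.
  have le_n k : k < q' -> k < n by move=> /leq_trans->; rewrite // (col_lengths_le q'C).
  apply/eqP; rewrite eqn_leq; apply/andP; split.
    apply: colmax_greatest iq' => k kq'; last exact: colmax_lt.
    by apply: leq_trans (colmax_le _ _ _) (le_bound _ (le_n _ kq')).
  apply: colmax_greatest iq' => k kq'; last exact: colmax_lt.
  rewrite -[X in bound _ X]/(val (Ordinal (le_n _ kq'))) bound_ord ffunE.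
  case: eqP => [ek|_]; last by rewrite -bound_ord colmax_le.
  by move: le_z; rewrite -ek.
move: TS; rewrite eq_set in_Dset => /andP[sT /tab_leP[_ _ leY]].
have szT := ssyt_size sT.
pose j := index q' (col_lengths la); pose j' := index q (col_lengths la).
have jC : j < size (col_lengths la) by rewrite index_mem.
have j'C : j' < size (col_lengths la) by rewrite index_mem.
have nj : nth 0 (col_lengths la) j = q' by apply: nth_index.
have nj' : nth 0 (col_lengths la) j' = q by apply: nth_index.
have jj' : j < j'.
  rewrite ltnNge; apply/negP => j'j.
  have tr : transitive geq by move=> a b c ba ac; apply: leq_trans ac ba.
  have := sorted_leq_nth tr leqnn 0 (col_lengths_sorted la) j' j j'C jC j'j.
  by rewrite nj nj' /= leqNgt lt_q.
have Tj : nth [::] T j = max_col be q' by rewrite nth_col_tab // nj.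
have Tj' : nth [::] T j' = max_col be' q by rewrite nth_col_tab // nj'.
have zT : val z \in nth [::] T j'.
  rewrite Tj'; apply/mapP; exists (val e); first by rewrite mem_iota -eq_e /=.
  by rewrite -eq_e colmax_last bound_ord ffunE eqxx.
have [_ _ colT rowT] := and4P sT.
(* The shorter column, further right, ends in [z]; hence the right key exceeds column [j], which is
   also the column of [Ytab]. *)
have [||i] := right_key_gt colT rowT jj' _ zT; rewrite ?Tj ?szT //.
rewrite size_mkseq => iq' lt_i.
have := leY j i; rewrite size_right_key szT => /(_ jC).
have [_ szK _] := tab_leP _ _ (tab_le_right_key colT rowT).
rewrite -szK ?szT // Tj size_mkseq => /(_ iq').
by rewrite -eq_max nth_col_tab // nj leqNgt lt_i.
Qed.

(** If [be k < be e], nestedness puts [be e] in the column of length [qq la h.+1], after row [k]. So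
    [k] is not its last row, and being critical it is followed by a gap; the missing value
    [(be k).+1] is the one to lower [be e] to. *)
Lemma critical_carrel_succ h (e k : 'I_n) : 0 < h -> e.+1 = qq la h ->
  carrel_of la k = h.+1 -> crit_row k -> be e <= be k.
Proof.
move=> h_gt0 eq_e eh ck; rewrite leqNgt; apply/negP => lt_k.
have [h_le le_k kq'] := carrel_ofP la k; rewrite eh /= in h_le le_k kq'.
have be_k := critical_eq n_gt0 be_up ck; rewrite /cend eh in be_k.
set q := qq la h in eq_e le_k; set q' := qq la h.+1 in be_k kq'.
have hr : h <= rnum la by lia.
have : val (be e) \in max_col be q'.
  apply: max_col_nested => //; apply/mapP; exists (val e).
    by rewrite mem_iota -/q -eq_e /=.
  by rewrite -/q -eq_e colmax_last bound_ord.
case/mapP=> j; rewrite mem_iota add0n => /= jq' be_e.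
have kj : k < j.
  rewrite ltnNge; apply/negP => jk.
  by have := colmax_addn b_up jk kq'; rewrite -be_e be_k; lia.
have gap : (be k).+1 < cmax q' k.+1.
  move: ck; rewrite /critical /critical_row /cend eh -/q' be_k.
  by case/orP=> [/eqP ek|//]; lia.
have zn : (be k).+1 < n by have := ltn_ord (be e); lia.
have z_notin : (be k).+1 \notin max_col be q'.
  apply/mapP => -[i]; rewrite mem_iota add0n => /= iq' z_i.
  case: (leqP i k) => [ik|ki].
    by have := colmax_addn b_up ik kq'; rewrite be_k; lia.
  by have := colmax_addn b_up ki iq'; lia.
have qC : q \in col_lengths la by rewrite qq_col_lengths // h_gt0.
case: (leqP h.+1 (rnum la)) => [hr'|lt_r].
  case/negP: z_notin; apply: (@lowered_bound_mem q q' e (Ordinal zn)) => //.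
  - by rewrite qq_col_lengths.
  - exact: qq_lt.
  have ek : e <= k by rewrite -eq_e in le_k; apply: ltnW.
  by have := colmax_addn b_up ek kq'; rewrite be_k /=; lia.
(* In the last carrel [q'] is [n], and a column of that length misses no value. *)
case/negP: z_notin; rewrite /q' max_col_key_qq // qq_default //.
have [s2 a2 o2] := key_colP pi (leqnn n).
by rewrite (sorted_ltn_iota o2 a2 s2) mem_iota.
Qed.

Lemma UGC_of_eq : UGC la be.
Proof.
apply/UGCP => // i k ik ci ck.
have := carrel_of_le la n_gt0 ik; rewrite leq_eqVlt => /orP[/eqP eh|lt_h].
  move: ik; rewrite leq_eqVlt => /orP[/eqP/val_inj-> //|ik].
  have := colmax_carrel_lt n_gt0 be_up eh ik; rewrite !critical_eq //; exact: ltnW.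
have [e eq_e [ie ehe ce]] := cend_last la n_gt0 be i.
have [h_le _ _] := carrel_ofP la i.
have le_ie : be i <= be e.
  have := colmax_addn b_up ie (eq_leq eq_e); rewrite critical_eq //.
  rewrite (_ : cend la i = cend la e) ?critical_eq //; first by lia.
  by rewrite /cend ehe.
apply: leq_trans le_ie _; rewrite -ehe in lt_h h_le.
have {eq_e} : e.+1 = qq la (carrel_of la e) by rewrite eq_e /cend ehe.
move: (carrel_of la e) lt_h h_le => h lt_h /andP[h_gt0 _] eq_e {i ik ci ehe ie}.
have [h'_le _ _] := carrel_ofP la k; move eh': (carrel_of la k) lt_h h'_le => h'.
(* Carrels are crossed one at a time, through their last indices, which are critical. *)
elim: h' k ck eh' => // h' IH k ck eh' lt_h h'_le.
move: lt_h; rewrite ltnS leq_eqVlt => /orP[/eqP eq_h|lt_h].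
  by rewrite -eq_h in eh'; apply: critical_carrel_succ eq_e eh' ck.
have [|f [eq_f ehf _]] := @carrel_rcons _ la n_gt0 h'; first by lia.
apply: (@leq_trans (be f)).
  apply: IH => //; last by lia.
  by apply: critical_last; rewrite eq_f /cend ehf.
by apply: critical_carrel_succ eh' ck => //; lia.
Qed.

(** Let [i] be the last row of the column of length [q'] with entry smaller than [pi c]. A gap
    follows, so the entry is the bound at [i]. If [q <= i], this critical entry is smaller than
    [pi a], hence than the critical entry ending carrel [h]. If [i < q], the columns of lengths [q]
    and [q'] agree up to row [i], so [pi b] already lies in the shorter one. *)
Lemma avoids_312_of_eq : avoids_312 la pi.
Proof.
move=> h a b c /andP[h_gt0 h_lt] aq /andP[qb bq'] q'c /andP[yz zx].
have hr : h <= rnum la by apply: ltnW.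
set q := qq la h in aq qb; set q' := qq la h.+1 in bq' q'c.
have lt_q : q < q' by apply: qq_lt.
have q'n : q' <= n by apply: qq_le_n.
have : val (pi a) \in max_col be q by rewrite mem_max_col.
case/mapP=> ix; rewrite mem_iota add0n => /= ixq ex.
have : val (pi a) \in max_col be q' by rewrite mem_max_col // (ltn_trans aq).
case/mapP=> jx; rewrite mem_iota add0n => /= jxq ejx.
have : val (pi b) \in max_col be q' by rewrite mem_max_col.
case/mapP=> iy; rewrite mem_iota add0n => /= iyq ey.
have y_notin : val (pi b) \notin max_col be q by rewrite mem_max_col // -leqNgt.
have z_notin : val (pi c) \notin max_col be q' by rewrite mem_max_col // -leqNgt.
pose P i := (i < q') && (cmax q' i < pi c).
have exP : exists i, P i by exists iy; rewrite /P iyq -ey.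
have leP i : P i -> i <= q' by case/andP=> /ltnW.
have [i /andP[iq' lt_z] maxi] := ex_maxnP exP leP.
have iyi : iy <= i by apply: maxi; rewrite /P iyq -ey.
have ijx : i < jx.
  rewrite ltnNge; apply/negP => jxi.
  by have := colmax_addn b_up jxi iq'; rewrite -ejx /=; lia.
have iq1 : i.+1 < q' by lia.
have gt_z : pi c < cmax q' i.+1.
  have nP : ~~ P i.+1 by apply/negP => /maxi; rewrite ltnn.
  move: nP; rewrite /P iq1 /= -leqNgt leq_eqVlt => /orP[/eqP ez|//].
  by case/mapP: z_notin; exists i.+1; rewrite ?mem_iota.
have gap : cmax q' i = bound be i by apply: colmax_gap => //; lia.
case: (ltnP i q) => [lt_i|le_i].
  case/mapP: y_notin; exists iy; first by rewrite mem_iota; lia.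
  rewrite /= ey; apply/eqP; rewrite eqn_leq colmax_anti //=; try lia.
  (* Splicing the shorter column into the longer one keeps it strict, since at row [i] the longer
     one already attains the bound. *)
  pose f k := if k <= i then cmax q k else cmax q' k.
  rewrite -[X in X <= _]/(cmax q iy) -[cmax q iy](_ : f iy = _);
    last by rewrite /f iyi.
  apply: colmax_greatest iyq => k kq'; rewrite /f.
    by case: ifP => _; apply: colmax_le.
  case: (ltngtP k i) => [ki|ik|->].
  - by apply: colmax_lt => //; lia.
  - exact: colmax_lt.
  by apply: leq_ltn_trans (colmax_le _ _ _) _; rewrite -gap colmax_lt.
have lt_in : i < n by lia.
pose o := Ordinal lt_in.
have eho : carrel_of la o = h.+1 by apply: carrel_of_eq => //=; rewrite le_i.
have co : crit_row o.
  by rewrite /critical /critical_row /cend eho -/q' /=; apply/orP; right; lia.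
have [|e [eq_e ehe _]] := @carrel_rcons _ la n_gt0 h; first by rewrite h_gt0 leqW.
have ce : crit_row e by apply: critical_last; rewrite eq_e /cend ehe.
have eo : e <= o by rewrite /= -/q in eq_e *; lia.
have := UGC_le n_gt0 be_up UGC_of_eq eo ce co.
rewrite -!bound_ord -gap; have ixe : ix <= e by rewrite -/q in eq_e; lia.
have := colmax_addn b_up ixe (eq_leq eq_e); have := colmax_le (bound be) q e.
rewrite -/q -ex /=; lia.
Qed.

Lemma Delta_eq_Psi : Delta la be = Psi la pi.
Proof.
apply/ffunP => i; apply: val_inj; rewrite /= Delta_colmax // ffunE /=.
have [/andP[h_gt0 _] _ lt_i] := carrel_ofP la i.
have qn : qq la (carrel_of la i) <= n by apply: qq_le_n.
set q := qq la _ in lt_i qn *; rewrite /cend -/q.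
have [sz _ _] := key_colP pi qn.
have szB : size (enum (Bset la pi (carrel_of la i))) = q by rewrite -[RHS]sz size_map.
(* Position [q - i.+1] of the decreasing list is position [i] of the increasing one, that is, row
   [i] of the key column. *)
rewrite nth_rev szB; last by lia.
rewrite (_ : q - (q - i.+1).+1 = i); last by lia.
rewrite -(nth_map i 0 val) ?szB // -[map _ _]/(key_col pi q) -max_col_key_qq //.
by rewrite nth_mkseq.
Qed.

End EqualSets.

Theorem theorem10p3 (n : nat) (hn : 0 < n) (la la' : n.-tuple nat)
    (hla : is_partition la) (hla' : is_partition la')
    (be : {ffun 'I_n -> 'I_n}) (hbe : upper be)
    (pi : 'S_n) (hpi : lambda_perm la' pi)
    (heq : row_bound_sum la be = demazure_poly la' pi) :
  [/\ Qtab la be = Ytab la' pi,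
      la = la' /\ Delta la be = Psi la pi,
      [/\ avoids_312 la pi, UG la (Delta la be) & UGC la be],
      exists2 phi : {ffun 'I_n -> 'I_n}, UF phi & Sset la be = Sset la phi
    & Sset la be = Dset la' pi /\
      (UF (Phi la (Delta la be)) /\
       Sset la be = Sset la (Phi la (Delta la be)))].
Proof.
have ela := poly_eq_shape hla hla' hbe heq; rewrite -ela in heq *.
have eq_max := poly_eq_max_tab hbe heq; have eq_set := poly_eq_set hbe heq.
have ugc := UGC_of_eq hn hbe eq_max eq_set.
have D_up := upper_Delta la hn hbe.
have ugD := UG_Delta hn hbe ugc; have /andP[ugcD _] := ugD.
have flag := UF_Phi hn D_up ugcD.
have eq_flag : Sset la be = Sset la (Phi la (Delta la be)).
  by rewrite -Sset_Phi // -Sset_Delta.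
split=> //.
- by rewrite Qtab_max_tab.
- by split=> //; apply: Delta_eq_Psi.
- by split=> //; apply: avoids_312_of_eq eq_set.
by exists (Phi la (Delta la be)).
Qed.
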